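(* Let $X=(X_s)_{s\in[0,T]}$ be a centered continuous Gaussian process generated by a linear bounded operator $u:H\to C([0,T])$ on a separable Hilbert space $H$, let $A=\{a_1,\dots,a_N\}\subset C([0,T])^*$ be a finite set of conditions, let $X^{(A)}$ be the conditioned process of $X$ with respect to $A$, and let $\{e_1,\dots,e_N\}$ be an orthonormal basis of the detached subspace $H_{(A)}$. Let $\mathbb P_X$ and $\mathbb P_{X^{(A)}}$ be the laws of $X$ and $X^{(A)}$ on $(C([0,T]),\mathcal C)$, and let $0\le s\le T$. Then $\mathbb P_X$ and $\mathbb P_{X^{(A)}}$ are equivalent on $\mathcal F_s$ if and only if there exist $e_i'\in H^{(A)}$, $1\le i\le N$, such that $$(ue_i')(x)=(ue_i)(x)\quad\text{for all }0\le x\le s .$$ Otherwise $\mathbb P_X$ and $\mathbb P_{X^{(A)}}$ are orthogonal (mutually singular) on $\mathcal F_s$.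
   Context: $C([0,T])$ is the Banach space of continuous real functions on $[0,T]$ with the supremum norm, $\mathcal C$ its Borel $\sigma$-algebra; $\mathcal F_s\subset\mathcal C$ is the smallest $\sigma$-algebra making all point evaluations $\delta_r(f)=f(r)$, $0\le r\le s$, measurable. A condition is an element $a$ of $C([0,T])^*$ (a finite signed Borel measure, $a(f)=\int f\,da$). ''$X$ is generated by $u$'' means that for every orthonormal basis $(h_i)_{i\ge1}$ of $H$ and independent standard normal $(\omega_i)_{i\ge1}$, the series $\sum_i\omega_i(uh_i)$ converges almost surely in $C([0,T])$ and has the law of $X$. Reduced Hilbert space: $H^{(A)}=\{h\in H: a(uh)=0\text{ for all }a\in A\}$. Detached subspace: $H_{(A)}=H\ominus H^{(A)}=\operatorname{span}\{u^*a:a\in A\}$ with $u^*$ the adjoint of $u$. If $\dim H_{(A)}<N$, an orthonormal basis of $H_{(A)}$ is padded with zero vectors to a list $e_1,\dots,e_N$. The conditioned process $X^{(A)}$ (defined only in law) is a continuous Gaussian process such that for all $b_1,\dots,b_n\in C([0,T])^*$ the law of $(b_1(X^{(A)}),\dots,b_n(X^{(A)}))$ is the conditional law of the Gaussian vector $(b_1(X),\dots,b_n(X))$ given $a(X)=0$ for all $a\in A$ in the sense of Gaussian conditioning, i.e. the law of $\big(b_k(X)-\mathbb E[b_k(X)\mid a(X),a\in A]\big)_{k=1}^n$. *)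

(* Defs.v *)
From HB Require Import structures.
From mathcomp Require Import all_boot all_order all_algebra.
From mathcomp Require Import all_classical all_reals all_analysis.

Set Implicit Arguments.
Unset Strict Implicit.
Unset Printing Implicit Defensive.

Import Order.TTheory GRing.Theory Num.Theory.
Import numFieldNormedType.Exports.

Local Open Scope classical_set_scope.
Local Open Scope ring_scope.

(** For [T < 0] the index set is empty and this is the zero space. *)
Definition cspace (R : realType) (T : R) : Type :=
  continuousType `[0, T]%classic R.

HB.instance Definition _ (R : realType) (T : R) := Choice.on (cspace T).

Definition ceval (R : realType) (T : R) (f : cspace T) (x : `[0, T]%classic)
  : R := f x.

Section cspace_normed.
Context {R : realType} (T : R).
Local Notation I := (`[0, T]%classic : Type).
Local Notation C := (cspace T).
Implicit Types f g : C.

Lemma ceval_continuous f : continuous (ceval f).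
Proof. exact: cts_fun. Qed.

Definition mkcspace (f : I -> R) (cf : continuous f) : C :=
  mkcts cf : continuousType _ _.

Lemma cspaceP f g : (forall x, ceval f x = ceval g x) -> f = g.
Proof. by move=> fg; apply/continuousEP. Qed.

Lemma cspace0_continuous : continuous (fun _ : I => 0 : R).
Proof. exact: cst_continuous. Qed.
Lemma cspaceD_continuous f g : continuous (fun x => ceval f x + ceval g x).
Proof.
by move=> x; exact: cvgD (@ceval_continuous f x) (@ceval_continuous g x).
Qed.
Lemma cspaceN_continuous f : continuous (fun x => - ceval f x).
Proof. by move=> x; exact: cvgN (@ceval_continuous f x). Qed.
Lemma cspaceZ_continuous a f : continuous (fun x => a * ceval f x).
Proof. by move=> x; exact: cvgM (cvg_cst a) (@ceval_continuous f x). Qed.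

Definition cspace0 := mkcspace cspace0_continuous.
Definition cspaceD f g := mkcspace (@cspaceD_continuous f g).
Definition cspaceN f := mkcspace (@cspaceN_continuous f).
Definition cspaceZ a f := mkcspace (@cspaceZ_continuous a f).

Lemma cspace_addA : associative cspaceD.
Proof. by move=> f g h; apply: cspaceP => x; exact: addrA. Qed.
Lemma cspace_addC : commutative cspaceD.
Proof. by move=> f g; apply: cspaceP => x; exact: addrC. Qed.
Lemma cspace_add0 : left_id cspace0 cspaceD.
Proof. by move=> f; apply: cspaceP => x; exact: add0r. Qed.
Lemma cspace_addN : left_inverse cspace0 cspaceN cspaceD.
Proof. by move=> f; apply: cspaceP => x; exact: addNr. Qed.

HB.instance Definition _ := GRing.isZmodule.Build C
  cspace_addA cspace_addC cspace_add0 cspace_addN.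

Lemma cspace_scaleA a b f : cspaceZ a (cspaceZ b f) = cspaceZ (a * b) f.
Proof. by apply: cspaceP => x; exact: mulrA. Qed.
Lemma cspace_scale1 : left_id 1 cspaceZ.
Proof. by move=> f; apply: cspaceP => x; exact: mul1r. Qed.
Lemma cspace_scaleDr : right_distributive cspaceZ +%R.
Proof. by move=> a f g; apply: cspaceP => x; exact: mulrDr. Qed.
Lemma cspace_scaleDl f : {morph cspaceZ^~ f : a b / a + b}.
Proof. by move=> a b; apply: cspaceP => x; exact: mulrDl. Qed.

HB.instance Definition _ := GRing.Zmodule_isLmodule.Build R C
  cspace_scaleA cspace_scale1 cspace_scaleDr cspace_scaleDl.

Definition supnorm f : R := sup [set `|ceval f x| | x in [set: I]].

Lemma supnorm_has_ubound f : has_ubound [set `|ceval f x| | x in [set: I]].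
Proof.
have [T0|T0] := leP 0 T; last first.
  exists 0 => _ [x _ <-]; have := valP x.
  rewrite inE/= in_itv/= => /andP[x0 xT].
  by have := le_trans x0 xT; rewrite leNgt T0.
pose g : R -> R := valL_ 0 (ceval f).
have cg : {within `[0, T]%classic, continuous g}.
  by apply/subspace_valL_continuousP'; exact: ceval_continuous.
have cf : {within `[0, T]%classic, continuous (fun x => `|g x|)}.
  by move=> x; apply: cvg_norm; exact: cg.
have [c _ cmax] := EVT_max T0 cf.
exists `|g c| => _ [x _ <-].
have -> : ceval f x = g (set_val x).
  by rewrite -[LHS](congr1 (@^~ x) (valLK 0 (ceval f))).
by apply: cmax; have := valP x; rewrite inE.
Qed.

Lemma le_supnorm f x : `|ceval f x| <= supnorm f.
Proof. by apply: ub_le_sup; [exact: supnorm_has_ubound|exists x]. Qed.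

Lemma supnorm_ge0 f : 0 <= supnorm f.
Proof.
rewrite /supnorm; have [->|/set0P[_ [x _ _]]] :=
  eqVneq [set `|ceval f x| | x in [set: I]] set0; first by rewrite sup0.
exact: le_trans (le_supnorm f x).
Qed.

Lemma supnorm_le f M : 0 <= M -> (forall x, `|ceval f x| <= M) -> supnorm f <= M.
Proof.
move=> M0 fM; rewrite /supnorm; have [->|/set0P ne] :=
  eqVneq [set `|ceval f x| | x in [set: I]] set0; first by rewrite sup0.
by apply: ge_sup => // _ [x _ <-].
Qed.

Lemma supnormD f g : supnorm (f + g) <= supnorm f + supnorm g.
Proof.
apply: supnorm_le => [|x]; first by rewrite addr_ge0// supnorm_ge0.
by rewrite (le_trans (ler_normD _ _))// lerD// le_supnorm.
Qed.

Lemma supnormZ_le (a : R) f : supnorm (a *: f) <= `|a| * supnorm f.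
Proof.
apply: supnorm_le => [|x]; first by rewrite mulr_ge0// supnorm_ge0.
by rewrite [ceval _ _]/(a * ceval f x) normrM ler_wpM2l// le_supnorm.
Qed.

Lemma supnormZ (a : R) f : supnorm (a *: f) = `|a| * supnorm f.
Proof.
apply/eqP; rewrite eq_le supnormZ_le/=.
have [->|a0] := eqVneq a 0; first by rewrite normr0 mul0r supnorm_ge0.
rewrite -ler_pdivlMl ?normr_gt0// -normfV.
by rewrite -{1}[f](scalerK a0) supnormZ_le.
Qed.

Lemma supnorm0_eq0 f : supnorm f = 0 -> f = 0.
Proof.
move=> f0; apply: cspaceP => x; apply/eqP; rewrite -normr_le0 -f0.
exact: le_supnorm.
Qed.

HB.instance Definition _ := Lmodule_isNormed.Build R C
  supnormD supnormZ supnorm0_eq0.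

Definition cspace_borel : set (set C) := <<s [set U : set C | open U] >>.

HB.instance Definition _ := @isMeasurable.Build default_measure_display C
  cspace_borel (@sigma_algebra0 _ _ _) (@sigma_algebraC _ _)
  (@sigma_algebra_bigcup _ _ _).

End cspace_normed.

Definition separable (V : topologicalType) :=
  exists D : set V, countable D /\ dense D.

Section hilbert.
Context {R : realType} {H : completeNormedModType R}.
Variable dot : {dot H for (@idfun R)}.

(** A real Hilbert space is a complete normed module whose norm comes from a dot
    product. *)
Definition hilbert_norm := forall x : H, dot x x = `|x| ^+ 2.

Definition orthonormal_on (D : set nat) (h : nat -> H) :=
  (forall i j, D i -> D j -> dot (h i) (h j) = (i == j)%:R) /\
  (forall i, ~ D i -> h i = 0).

(** Orthonormal basis of [H], with [H] of finite or countably infinite dimension;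
    in dimension [m] the list [h 0, ..., h m.-1] is padded with zeros. *)
Definition orthonormal_basis (h : nat -> H) :=
  exists D : set nat,
    [/\ D = [set: nat] \/ (exists m, D = `I_m),
        orthonormal_on D h &
        dense [set x : H | exists n (c : nat -> R), x = \sum_(i < n) c i *: h i]].

(** [e] is an orthonormal basis of the subspace [V], padded with zeros to a list
    of length [N]. *)
Definition padded_orthonormal_basis (V : set H) (N : nat) (e : 'I_N -> H) :=
  exists m : nat,
    [/\ (m <= N)%N,
        forall i j : 'I_N, (i < m)%N -> (j < m)%N ->
          dot (e i) (e j) = (i == j)%:R,
        forall i : 'I_N, (m <= i)%N -> e i = 0 &
        V = [set x | exists c : 'I_N -> R, x = \sum_(i < N) c i *: e i]].

Definition orthocomplement (V : set H) : set H :=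
  [set x | forall y, V y -> dot x y = 0].

End hilbert.

Section conditions.
Context {R : realType} {T : R} {H : completeNormedModType R}.
Variables (dot : {dot H for (@idfun R)}) (u : {linear H -> cspace T}).
Variables (N : nat) (a : 'I_N -> {linear cspace T -> R}).

Definition reduced_space : set H := [set h | forall i, a i (u h) = 0].

(** H_(A) = H minus H^(A), in the sense of orthogonal complements. *)
Definition detached_space : set H := orthocomplement dot reduced_space.

End conditions.

(** The normal law N(m, s^2), including the degenerate case [s = 0], for which
    [normal_prob] is not the Dirac mass. *)
Definition gaussian_law (R : realType) (m s : R) (B : set R) : \bar R :=
  if s == 0 then \d_m B else normal_prob m s B.

Section gaussian.
Context d {Omega : measurableType d} {R : realType} (P : probability Omega R).

Definition is_gaussian (Z : Omega -> R) :=
  measurable_fun [set: Omega] Z /\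
  exists m s : R, forall B : set R, measurable B ->
    P (Z @^-1` B) = gaussian_law m s B.

(** Finite-dimensional distributions are Gaussian: a random vector is Gaussian
    when all linear combinations of its coordinates are. *)
Definition gaussian_process (T : R) (X : Omega -> cspace T) :=
  forall n (r : 'I_n -> `[0, T]%classic) (c : 'I_n -> R),
    is_gaussian (fun w => \sum_(k < n) c k * ceval (X w) (r k)).

Definition centered_process (T : R) (X : Omega -> cspace T) :=
  forall r : `[0, T]%classic, ('E_P[fun w => ceval (X w) r] = 0)%E.

Definition standard_normal (Z : Omega -> R) :=
  measurable_fun [set: Omega] Z /\
  forall B : set R, measurable B -> P (Z @^-1` B) = normal_prob 0 1 B.

Definition mutually_independent (Z : nat -> Omega -> R) :=
  forall (J : seq nat) (B : nat -> set R),
    uniq J -> (forall j, measurable (B j)) ->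
    P (\bigcap_(j in [set` J]) (Z j @^-1` B j)) =
    (\prod_(j <- J) P (Z j @^-1` B j))%E.

(** [Z] is a version of E[W | G], for a sub-sigma-algebra [G]. *)
Definition is_cond_expectation (G : set (set Omega)) (W Z : Omega -> R) :=
  [/\ forall B : set R, measurable B -> G (Z @^-1` B),
      P.-integrable [set: Omega] (EFin \o Z) &
      forall E, G E ->
        (\int[P]_(w in E) (Z w)%:E = \int[P]_(w in E) (W w)%:E)%E].

End gaussian.

Section same_law.
Context d1 d2 d3 {Omega1 : measurableType d1} {Omega2 : measurableType d2}
  {S : measurableType d3} {R : realType}.

Definition same_law (P1 : probability Omega1 R) (X1 : Omega1 -> S)
    (P2 : probability Omega2 R) (X2 : Omega2 -> S) :=
  forall B : set S, measurable B -> P1 (X1 @^-1` B) = P2 (X2 @^-1` B).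

End same_law.

(** A measurable [S] carries the almost sure sum of the random series. *)
Definition generated_by (R : realType) (T : R) (H : completeNormedModType R)
    (dot : {dot H for (@idfun R)}) (u : {linear H -> cspace T})
    d (Omega : measurableType d) (P : probability Omega R)
    (X : {mfun Omega >-> cspace T}) :=
  forall h : nat -> H, orthonormal_basis dot h ->
  forall d' (Omega' : measurableType d') (P' : probability Omega' R)
    (w : nat -> Omega' -> R),
    (forall i, standard_normal P' (w i)) -> mutually_independent P' w ->
  exists S : {mfun Omega' >-> cspace T},
    (\forall x \ae P', series (fun i => w i x *: u (h i)) @ \oo --> S x) /\
    same_law P' S P X.

(** [Y] has the law of X^(A), where A = {a_0, ..., a_(N-1)}. The conditional
    expectations are almost surely unique, so the choice of the versions [Z k] is
    immaterial. *)
Definition conditioned_process (R : realType) (T : R)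
    d (Omega : measurableType d) (P : probability Omega R)
    (X : {mfun Omega >-> cspace T})
    (N : nat) (a : 'I_N -> {linear cspace T -> R})
    d' (Omega' : measurableType d') (Q : probability Omega' R)
    (Y : {mfun Omega' >-> cspace T}) :=
  gaussian_process Q Y /\
  forall n (b : 'I_n -> {linear cspace T -> R}),
    (forall k, continuous (b k)) ->
  exists Z : 'I_n -> Omega -> R,
    (forall k, is_cond_expectation P
       (g_sigma_preimage (fun i w => a i (X w))) (fun w => b k (X w)) (Z k)) /\
    same_law Q (fun w => [tuple b k (Y w) | k < n])
             P (fun w => [tuple b k (X w) - Z k w | k < n]).

Definition eval_sigma_algebra (R : realType) (T s : R) :
    set (set (cspace T)) :=
  <<s \bigcup_(r in [set r : `[0, T]%classic | \val r <= s])
        preimage_set_system [set: cspace T] (fun f => ceval f r) measurable >>.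

Section compare.
Context {R : realType} {S : Type} (F : set (set S)) (mu nu : set S -> \bar R).

Definition equivalent_on := forall B, F B -> mu B = 0%E <-> nu B = 0%E.

Definition singular_on := exists B, [/\ F B, mu B = 0%E & nu (~` B) = 0%E].

End compare.

(* Main.v *)
(* A functional b (u x) = <k, x> has law |k| N(0, 1) under the law of X: take a
   basis starting with k / |k|. Flipping the signs of the basis of H^(A) leaves the
   law of X unchanged, and by this symmetry b(X) - E[b(X) | a(X), a in A] is
   b(X - sum_j c_j(X) u e_j), where c_j is the combination of the conditions with
   c_j (u x) = <e_j, x>. So X^(A) is generated by u composed with the projection
   onto H^(A).

   If e_j' matches e_j on [0, s], then after a rotation of the plane spanned by e_j
   and e_j', projecting e_j away only rescales one Gaussian coordinate of the path
   on [0, s], which preserves null sets; the e_j are projected away one at a time.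

   If there is no matching then, by a Riesz argument, the ratio of the variance
   under X to the variance under X^(A) is unbounded over linear combinations of
   evaluations on [0, s]. Normalised combinations which are small under X^(A) and
   not small under X, with summable probabilities of the exceptions, give
   singularity by Borel-Cantelli.

   The laws are only described through i.i.d. standard normal sequences, which are
   constructed from binary digits and quantile functions. *)
Require Import Defs.
From HB Require Import structures.
From mathcomp Require Import all_boot all_order all_algebra.
From mathcomp Require Import all_classical all_reals all_analysis.
From mathcomp Require Import measurable_realfun ring lra.

Set Implicit Arguments.
Unset Strict Implicit.
Unset Printing Implicit Defensive.

Import Order.TTheory GRing.Theory Num.Theory.
Import numFieldNormedType.Exports.

Local Open Scope classical_set_scope.
Local Open Scope ring_scope.

(** * Independent standard normal sequences *)

(** [generated_by] quantifies over all i.i.d. normal sequences, so it yields nothing until one is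
    exhibited; this is why a sequence is constructed. The freedom to choose the sample space also
    drives the equivalence: two series are summed on one space under two probabilities with the same
    null sets, and on $[0,s]$ their sums agree almost surely. No density on path space and no
    general dichotomy for Gaussian measures enters; absolute continuity is used only on the line,
    where N(0,1) and its dilations share the null sets of Lebesgue measure.

    In the converse, the vectors representing evaluation combinations form a subspace that need not
    be closed, and after projection the functional to be represented is not single-valued a priori.
    A bounded linear graph takes care of both. That equivalence implies matching follows from the
    singular case, as two laws of mass one cannot be equivalent and singular at once. *)

Lemma measurable_preimage d d' (Omega : measurableType d) (S : measurableType d')
    (f : Omega -> S) (B : set S) :
  measurable_fun setT f -> measurable B -> measurable (f @^-1` B).
Proof. by move=> mf mB; rewrite -[X in measurable X]setTI; exact: mf. Qed.

Lemma ae_iff_measure d (Omega : measurableType d) (R : realType)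
    (P : {measure set Omega -> \bar R}) (A1 A2 : set Omega) :
  measurable A1 -> measurable A2 -> {ae P, forall x, A1 x <-> A2 x} -> P A1 = P A2.
Proof.
move=> m1 m2 [N [mN N0 EN]].
have E x : ~ N x -> A1 x <-> A2 x.
  by move=> nNx; apply: contrapT => nS; apply: nNx; apply: EN.
have le B1 B2 : measurable B1 -> measurable B2 -> (forall x, ~ N x -> B1 x -> B2 x) ->
    (P B1 <= P B2)%E.
  move=> mB1 mB2 B12; apply: (@le_trans _ _ (P (B2 `|` N))).
    apply: le_measure; rewrite ?inE//; first exact: measurableU.
    by move=> x B1x; have [Nx|nNx] := pselect (N x); [right|left; exact: B12].
  by rewrite (measureU0 mB2 mN N0).
by apply/eqP; rewrite eq_le; apply/andP; split; apply: le => // x /E [].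
Qed.

(** * Independent sequences from a shift *)

Section shift.
Context d d' (Omega : measurableType d) (S : measurableType d') (R : realType).
Variables (P : probability Omega R) (Z : Omega -> S) (D : Omega -> Omega).
Hypotheses (mZ : measurable_fun setT Z) (mD : measurable_fun setT D).
Hypothesis ZD : forall A C, measurable A -> measurable C ->
  P (Z @^-1` A `&` D @^-1` C) = (P (Z @^-1` A) * P C)%E.

Lemma measurable_iter n : measurable_fun setT (iter n D).
Proof.
elim: n => [|n IHn]; first exact: measurable_id.
exact: (measurableT_comp mD IHn).
Qed.

Lemma shift_preserving n C : measurable C -> P (iter n D @^-1` C) = P C.
Proof.
move=> mC; elim: n => [//|n IHn].
have mI : measurable (iter n D @^-1` C).
  exact: measurable_preimage (measurable_iter n) mC.
have -> : iter n.+1 D @^-1` C = D @^-1` (iter n D @^-1` C).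
  by apply/seteqP; split => x /=; rewrite -iterS iterSr.
have := ZD (@measurableT _ S) mI.
by rewrite preimage_setT setTI probability_setT mul1e => ->.
Qed.

(** Induction on the length: the constraint on [Z] splits off, the others form an event in [D x],
    and [ZD] factors the two. *)
Lemma shift_cylinder n (A : nat -> set S) : (forall i, measurable (A i)) ->
  P [set x | forall i, (i < n)%N -> A i (Z (iter i D x))] =
  (\prod_(i < n) P (Z @^-1` A i))%E.
Proof.
move=> mA; elim: n A mA => [|n IHn] A mA.
  by rewrite big_ord0 -[RHS](probability_setT P); congr (P _); apply/seteqP; split.
rewrite big_ord_recl -(IHn (fun i => A i.+1))// -ZD//; last first.
  rewrite (_ : [set _ | _] = \bigcap_(i < n) ((Z \o iter i D) @^-1` A i.+1)).
    apply: bigcap_measurableType => i _; apply: measurable_preimage => //.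
    exact: measurableT_comp mZ (measurable_iter i).
  by apply/seteqP; split => x /=.
congr (P _); apply/seteqP; split => x /=.
  move=> Ax; split; first exact: (Ax 0%N).
  by move=> i ilt; have := Ax i.+1 ilt; rewrite iterSr.
move=> [A0 Ax] [//|i] ilt; rewrite iterSr; exact: Ax.
Qed.

End shift.

Lemma shift_independent d (Omega : measurableType d) (R : realType)
    (P : probability Omega R) (Z : Omega -> R) (D : Omega -> Omega) :
  measurable_fun setT Z -> measurable_fun setT D ->
  (forall A C, measurable A -> measurable C ->
    P (Z @^-1` A `&` D @^-1` C) = (P (Z @^-1` A) * P C)%E) ->
  mutually_independent P (fun i => Z \o iter i D).
Proof.
move=> mZ mD ZD J B uJ mB.
pose n := (\max_(j <- J) j).+1.
have Jn j : j \in J -> (j < n)%N by move=> jJ; rewrite ltnS; exact: leq_bigmax_seq.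
(* Indices outside [J] get the whole line as constraint, which turns the finite family into an
   initial segment. *)
pose A i := if i \in J then B i else setT.
have mA i : measurable (A i) by rewrite /A; case: ifP.
have -> : \bigcap_(j in [set` J]) ((Z \o iter j D) @^-1` B j) =
   [set x | forall i, (i < n)%N -> A i (Z (iter i D x))].
  apply/seteqP; split => x /= Bx i.
    by move=> _; rewrite /A; case: ifPn => // iJ; exact: Bx.
  by move=> /= iJ; have := Bx i (Jn _ iJ); rewrite /A iJ.
rewrite (shift_cylinder mZ mD ZD)//.
rewrite -(big_mkord xpredT (fun i => P (Z @^-1` A i))).
transitivity (\prod_(0 <= i < n | i \in J) P (Z @^-1` B i))%E.
  rewrite [RHS]big_mkcond/=; apply: eq_bigr => i _; rewrite /A; case: ifP => // _.
  by rewrite preimage_setT probability_setT.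
rewrite -big_filter; transitivity (\prod_(j <- J) P (Z @^-1` B j))%E.
  apply: perm_big; apply: uniq_perm => //; first by rewrite filter_uniq// iota_uniq.
  move=> i; rewrite mem_filter mem_index_iota/=.
  by case: (boolP (i \in J)) => //= /Jn ->.
apply: eq_bigr => j _.
have -> : (Z \o iter j D) @^-1` B j = iter j D @^-1` (Z @^-1` B j) by [].
by rewrite (shift_preserving mD ZD)//; exact: measurable_preimage.
Qed.

(** Phrased through preimages, so that the laws of two maps on different spaces can be compared
    directly. *)
Lemma pi_system_unique d1 d2 d3 (Omega1 : measurableType d1)
    (Omega2 : measurableType d2) (S : measurableType d3) (R : realType)
    (m1 : {measure set Omega1 -> \bar R}) (m2 : {measure set Omega2 -> \bar R})
    (f1 : Omega1 -> S) (f2 : Omega2 -> S) (G : set (set S)) :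
  measurable_fun setT f1 -> measurable_fun setT f2 ->
  G `<=` measurable -> setI_closed G -> G setT -> (m1 setT < +oo)%E ->
  (forall A, G A -> m1 (f1 @^-1` A) = m2 (f2 @^-1` A)) ->
  forall A, <<s G >> A -> m1 (f1 @^-1` A) = m2 (f2 @^-1` A).
Proof.
move=> mf1 mf2 Gm GI GT m1oo G12.
pose p1 : {measure set S -> \bar R} :=
  @measure_function_pushforward__canonical__measure_function_Measure
    _ _ _ _ _ m1 _ mf1.
pose p2 : {measure set S -> \bar R} :=
  @measure_function_pushforward__canonical__measure_function_Measure
    _ _ _ _ _ m2 _ mf2.
apply: (g_sigma_algebra_measure_unique G Gm (fun=> setT) _ _ p1 p2) => //.
by apply/seteqP; split => // x _; exists 0%N.
Qed.

Lemma real_law_unique d1 d2 (Omega1 : measurableType d1)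
    (Omega2 : measurableType d2) (R : realType)
    (m1 : {measure set Omega1 -> \bar R}) (m2 : {measure set Omega2 -> \bar R})
    (f1 : Omega1 -> R) (f2 : Omega2 -> R) :
  measurable_fun setT f1 -> measurable_fun setT f2 ->
  m1 setT = m2 setT -> (m1 setT < +oo)%E ->
  (forall x, m1 [set w | f1 w <= x] = m2 [set w | f2 w <= x]) ->
  forall A, measurable A -> m1 (f1 @^-1` A) = m2 (f2 @^-1` A).
Proof.
move=> mf1 mf2 m12 m1oo f12 A mA.
(* The whole line joins the half-lines because the uniqueness lemma wants [setT] in the system. *)
pose G : set (set R) := [set B | B = setT \/ exists x, B = `]-oo, x]%classic].
apply: (@pi_system_unique _ _ _ _ _ _ _ m1 m2 _ _ G) => //.
- by move=> _ [->|[x ->]].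
- move=> _ _ [->|[x ->]] [->|[y ->]]; rewrite ?setTI ?setIT.
  + by left.
  + by right; exists y.
  + by right; exists x.
  + right; exists (Num.min x y); apply/seteqP.
    by split => z /=; rewrite !in_itv/= le_min => /andP.
- by left.
- move=> _ [->|[x ->]]; first by rewrite !preimage_setT.
  have E d (T : measurableType d) (f : T -> R) :
      f @^-1` `]-oo, x] = [set w | f w <= x].
    by apply/seteqP; split => w /=; rewrite in_itv.
  by rewrite !E.
- move: mA; rewrite -[measurable A]/((@ocitv R).-sigma.-measurable A).
  rewrite measurable_realfun.RGenOInfty.measurableE; apply: smallest_sub.
    exact: smallest_sigma_algebra.
  move=> _ [x ->]; rewrite -setCitvl.
  have /(@sigma_algebraC _ G) : <<s G >> `]-oo, x]%classic.
    by apply: sub_sigma_algebra; right; exists x.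
  by [].
Qed.

(** * Binary digits of a uniform variable *)

Section dyadic.
Variable R : realType.
Local Notation U := (uniform_prob (@ltr01 R)).

Definition bit (x : R) : bool := 2^-1 <= x.
(** On $[0,1[$ this is $2x$ modulo 1. The point 1 is fixed instead of being sent to 0, so $[0,1]$ is
    stable and so is its complement. *)
Definition doubling (x : R) : R := 2 * x - (bit x)%:R.

Lemma measurable_bit : measurable_fun setT bit.
Proof. exact: measurable_fun_ler. Qed.

Lemma measurable_doubling : measurable_fun setT doubling.
Proof.
apply: measurable_funB; first exact: measurable_funM.
apply: (@measurableT_comp _ _ _ _ _ _ (fun b : bool => b%:R : R)) => //.
exact: measurable_bit.
Qed.

Lemma uniform01E (A : set R) : measurable A ->
  U A = lebesgue_measure (A `&` `[0, 1]).
Proof.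
move=> mA; rewrite /uniform_prob integral_uniform_pdf.
rewrite (eq_integral (fun=> 1%E)); last first.
  move=> x; rewrite inE/= in_itv/= => -[_ x01].
  by rewrite /uniform_pdf x01 subr0 invr1.
by rewrite integral_cst ?mul1e//; exact: measurableI.
Qed.

(** On each half of $[0,1]$ the map is affine of slope two and fills $[0,1]$ up to an endpoint, so
    preimages have half the length. The two finite measures are compared on half-lines. *)
Lemma bit_doubling_half (b : bool) (C : set R) : measurable C ->
  U (bit @^-1` [set b] `&` doubling @^-1` C) = ((2^-1)%:E * U C)%E.
Proof.
move=> mC.
have mb : measurable (bit @^-1` [set b]) by exact: measurable_preimage measurable_bit _.
pose m1 := mrestr U mb.
have h0 : (0 : R) <= 2^-1 by [].
pose m2 := mscale (NngNum h0) U.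
have h2 : (2^-1 < 1 :> R) by rewrite invf_lt1// ltr1n.
have key x : m1 [set w | doubling w <= x] = m2 [set w | w <= x].
  have mh (y : R) : measurable [set w : R | w <= y].
    by rewrite (_ : [set _ | _] = `]-oo, y]%classic)//; apply/seteqP; split => z /=; rewrite in_itv.
  rewrite /m1 /m2 /mrestr /mscale/= !uniform01E//; last first.
    apply: measurableI => //.
    have := measurable_preimage measurable_doubling (mh x); exact.
  have [x0|x0] := ltP x 0.
    rewrite [X in (_ = _ * lebesgue_measure X)%E](_ : _ = set0); last first.
      apply/seteqP; split => // z []/=; rewrite in_itv/= => zx /andP[z0 _].
      by lra.
    rewrite [X in (lebesgue_measure X = _)%E](_ : _ = set0); last first.
      apply/seteqP; split => // z [[]]/=; rewrite in_itv/= /doubling /bit.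
      by move=> h _ /andP[]; move: h; case: (leP 2^-1 z) => /= ? ? ? ?; lra.
    by rewrite measure0 mule0.
  have [x1|x1] := leP 1 x.
    rewrite [X in (_ = _ * lebesgue_measure X)%E](_ : _ = `[0, 1]%classic); last first.
      apply/seteqP; split => z /=; first by case.
      by move=> z01; split => //; move: z01; rewrite in_itv/= => /andP[]; lra.
    (* The point $1/2$ has digit one; [BSide (~~ b)] therefore leaves the right end open for the
       lower half only. *)
    rewrite [X in (lebesgue_measure X = _)%E](_ : _ =
      [set` Interval (BLeft (if b then 2^-1 else 0)) (BSide (~~ b) (if b then 1 else 2^-1))]); last first.
      apply/seteqP; split => z /=.
        rewrite !in_itv/= /doubling /bit => -[[h <-]].
        by move: h; case: (leP 2^-1 z) => /= ? ? /andP[? ?]; apply/andP; split; lra.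
      rewrite !in_itv/= /doubling /bit; case: b mb m1 => ? ? /= /andP[h1 h3].
        by rewrite h1/=; split; [split|apply/andP; split]; lra.
      by rewrite (leNgt 2^-1) h3/=; split; [split|apply/andP; split]; lra.
    rewrite !lebesgue_measure_itv/=; case: b mb m1 => ? ? /=;
      rewrite !lte_fin ?ltr01 ?h2 ?invr_gt0 ?ltr0n//= -!EFinD -?EFinM;
      by congr EFin; lra.
  rewrite [X in (_ = _ * lebesgue_measure X)%E](_ : _ = `[0, x]%classic); last first.
    apply/seteqP; split => z /=; rewrite !in_itv/=.
      by case=> ? /andP[? ?]; apply/andP; split.
    by move=> /andP[? ?]; split => //; apply/andP; split => //; lra.
  rewrite [X in (lebesgue_measure X = _)%E](_ : _ =
      [set` Interval (BLeft (if b then 2^-1 else 0)) (BRight (if b then 2^-1 * (x + 1) else 2^-1 * x))]); last first.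
    apply/seteqP; split => z /=.
      rewrite !in_itv/= /doubling /bit => -[[h <-]].
      by move: h; case: (leP 2^-1 z) => /= ? ? /andP[? ?]; apply/andP; split; lra.
    rewrite !in_itv/= /doubling /bit; case: b mb m1 => ? ? /= /andP[h1 h3].
      by rewrite h1/=; split; [split|apply/andP; split]; lra.
    have h4 : z < 2^-1 by lra.
    by rewrite (leNgt 2^-1) h4/=; split; [split|apply/andP; split]; lra.
  rewrite !lebesgue_measure_itv/=.
  have [->|xn0] := eqVneq x 0.
    case: b mb m1 => ? ? /=.
      by rewrite add0r mulr1 !lte_fin !ltxx mule0.
    by rewrite mulr0 !lte_fin !ltxx mule0.
  have x00 : 0 < x by rewrite lt_neqAle eq_sym xn0.
  case: b mb m1 => ? ? /=; rewrite !lte_fin x00.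
    have -> : 2^-1 < 2^-1 * (x + 1) by lra.
    by rewrite -!EFinD -EFinM; congr EFin; lra.
  have -> : 0 < 2^-1 * x by lra.
  by rewrite -!EFinD -EFinM; congr EFin; lra.
(* Both measures live on $[0,1]$, so the total masses are the values on the half-line ending at 1,
   already compared in [key]. *)
have m1T : m1 setT = m2 setT.
  have E (m : set R -> \bar R) : (forall A, measurable A -> m A = m (A `&` `[0, 1])) ->
      m setT = m [set w | w <= 1].
    move=> mE; rewrite mE// [RHS]mE; last first.
      by rewrite (_ : [set _ | _] = `]-oo, 1]%classic)//;
        apply/seteqP; split => z /=; rewrite in_itv.
    congr m; apply/seteqP; split => z /= [_ z01]; split => //.
    by move: z01; rewrite in_itv/= => /andP[].
  transitivity (m1 [set w | doubling w <= 1]).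
    have mD1 : measurable [set w | doubling w <= 1].
      rewrite (_ : [set _ | _] = doubling @^-1` `]-oo, 1]).
        exact: measurable_preimage measurable_doubling _.
      by apply/seteqP; split => z /=; rewrite in_itv.
    rewrite /m1 /mrestr !uniform01E ?setTI//; last exact: measurableI.
    congr lebesgue_measure; apply/seteqP; split => z /= []; last first.
      by move=> [_ bz] z01; split.
    move=> bz z01; split => //; split => //; move: z01.
    rewrite in_itv/= /doubling /bit.
    by case: (leP 2^-1 z) => /= ? /andP[? ?]; lra.
  rewrite key; apply/esym/E => A mA; rewrite /m2 /mscale/=; congr (_ * _)%E.
  rewrite !uniform01E//; last exact: measurableI.
  by rewrite -setIA setIid.
have m1oo : (m1 setT < +oo)%E.
  rewrite m1T /m2 /mscale/= -[uniform_prob _]/U probability_setT mule1.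
  exact: ltry.
have := @real_law_unique _ _ _ _ _ m1 m2 doubling id measurable_doubling
   (@measurable_id _ _ _) m1T m1oo key C mC.
by rewrite /m1 /m2 /mrestr /mscale/= setIC.
Qed.

Lemma uniform_bit (b : bool) : U (bit @^-1` [set b]) = (2^-1)%:E.
Proof.
have := bit_doubling_half b (@measurableT _ R).
by rewrite preimage_setT setIT probability_setT mule1.
Qed.

Lemma bit_doubling (A : set bool) (C : set R) : measurable A -> measurable C ->
  U (bit @^-1` A `&` doubling @^-1` C) = (U (bit @^-1` A) * U C)%E.
Proof.
move=> _ mC.
have mb b : measurable (bit @^-1` [set b]) by exact: measurable_preimage measurable_bit _.
have mDC := measurable_preimage measurable_doubling mC.
have half (D : set R) : measurable D -> U (doubling @^-1` D) = U D.
  move=> mD; have mDD := measurable_preimage measurable_doubling mD.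
  have -> : doubling @^-1` D = (bit @^-1` [set true] `&` doubling @^-1` D) `|`
      (bit @^-1` [set false] `&` doubling @^-1` D).
    apply/seteqP; split => z /=; last by case => -[].
    by case: (bit z) => Dz; [left|right].
  rewrite measureU//; [|exact: (measurableI _ _ (mb true) mDD)|exact: (measurableI _ _ (mb false) mDD)|].
    transitivity ((2^-1)%:E * U D + (2^-1)%:E * U D)%E.
      by congr (_ + _)%E; exact: bit_doubling_half.
    rewrite -ge0_muleDl ?lee_fin//.
    rewrite (_ : _ + _ = 1)%E ?mul1e// -EFinD; congr EFin.
    by rewrite [RHS]splitr div1r.
  by apply/seteqP; split => z //= [[->] _ []].
have [At|At] := pselect (A true); have [Af|Af] := pselect (A false).
- have -> : A = setT by apply/seteqP; split => // -[].
  by rewrite preimage_setT setTI half// probability_setT mul1e.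
- have -> : A = [set true] by apply/seteqP; split => -[].
  by rewrite bit_doubling_half// uniform_bit.
- have -> : A = [set false] by apply/seteqP; split => -[].
  by rewrite bit_doubling_half// uniform_bit.
- have -> : A = set0 by apply/seteqP; split => -[].
  by rewrite preimage_set0 set0I measure0 mul0e.
Qed.

End dyadic.

(** Two passes of uniqueness, one per factor: with one event fixed, both sides are finite measures
    of the other event, namely a restriction and a multiple of [P]. *)
Lemma independent_pi d d1 d2 (Omega : measurableType d) (S1 : measurableType d1)
    (S2 : measurableType d2) (R : realType) (P : probability Omega R)
    (f : Omega -> S1) (g : Omega -> S2) (G1 : set (set S1)) (G2 : set (set S2)) :
  measurable_fun setT f -> measurable_fun setT g ->
  G1 `<=` measurable -> setI_closed G1 -> G1 setT ->
  G2 `<=` measurable -> setI_closed G2 -> G2 setT ->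
  (forall A B, G1 A -> G2 B ->
    P (f @^-1` A `&` g @^-1` B) = (P (f @^-1` A) * P (g @^-1` B))%E) ->
  forall A B, <<s G1 >> A -> <<s G2 >> B ->
    P (f @^-1` A `&` g @^-1` B) = (P (f @^-1` A) * P (g @^-1` B))%E.
Proof.
move=> mf mg G1m G1I G1T G2m G2I G2T G12.
have step d3 d4 (S3 : measurableType d3) (S4 : measurableType d4)
    (f' : Omega -> S3) (g' : Omega -> S4) (G : set (set S3)) (B : set S4) :
    measurable_fun setT f' -> measurable_fun setT g' -> measurable B ->
    G `<=` measurable -> setI_closed G -> G setT ->
    (forall A, G A ->
      P (f' @^-1` A `&` g' @^-1` B) = (P (f' @^-1` A) * P (g' @^-1` B))%E) ->
    forall A, <<s G >> A ->
      P (f' @^-1` A `&` g' @^-1` B) = (P (f' @^-1` A) * P (g' @^-1` B))%E.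
  move=> mf' mg' mB Gm GI GT GE A GA.
  have mgB := measurable_preimage mg' mB.
  have p0 : 0 <= fine (P (g' @^-1` B)) by exact: fine_ge0.
  have pE : (fine (P (g' @^-1` B)))%:E = P (g' @^-1` B).
    by rewrite fineK ?fin_num_measure.
  have mE C : mscale (NngNum p0) P C = (P C * P (g' @^-1` B))%E.
    by rewrite /mscale/= pE muleC.
  rewrite -mE -[LHS]/(mrestr P mgB (f' @^-1` A)).
  apply: (@pi_system_unique _ _ _ _ _ _ _ _ _ f' f' G) => //.
  - rewrite -[X in (X < _)%E]/(P (setT `&` g' @^-1` B)) setTI (le_lt_trans (probability_le1 _ _))//; exact: ltry.
  - by move=> C GC; apply: etrans (GE C GC) _; rewrite -mE.
have sub d3 (S3 : measurableType d3) (G : set (set S3)) :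
    G `<=` measurable -> <<s G >> `<=` measurable.
  by move=> Gm; apply: smallest_sub => //; exact: sigma_algebra_measurable.
move=> A B GA GB.
apply: (step _ _ _ _ f g G1) => //; first exact: (sub _ _ _ G2m).
move=> {GA}A GA; rewrite setIC muleC.
apply: (step _ _ _ _ g f G2) => //; first exact: G1m.
by move=> {GB}B GB; rewrite setIC muleC; exact: G12.
Qed.

(** * Fair coin tossing on bit sequences *)

Section cantor_measure.
Variable R : realType.
Local Notation U := (uniform_prob (@ltr01 R)).

Definition bit_cylinder (n : nat) (A : nat -> set bool) : set (nat -> bool) :=
  [set y | forall i, (i < n)%N -> A i (y i)].

Definition bit_cylinders : set (set (nat -> bool)) :=
  [set B | exists n A, B = bit_cylinder n A].

Lemma bit_cylinders_setI : setI_closed bit_cylinders.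
Proof.
move=> _ _ [n [A ->]] [m [B ->]]; exists (maxn n m).
exists (fun i => [set b | ((i < n)%N -> A i b) /\ ((i < m)%N -> B i b)]).
apply/seteqP; split => y /=.
  by move=> [Ay By] i _; split => im; [exact: Ay|exact: By].
move=> ABy; split=> i im.
  by apply: (ABy i _).1 => //; rewrite leq_max im.
by apply: (ABy i _).2 => //; rewrite leq_max im orbT.
Qed.

Lemma bit_cylinders_setT : bit_cylinders setT.
Proof. by exists 0%N, (fun=> setT); apply/seteqP; split. Qed.

Local Notation bitseqs := (g_sigma_algebraType bit_cylinders).

Lemma measurable_bit_cylinder n A : measurable (bit_cylinder n A : set bitseqs).
Proof. by apply: sub_sigma_algebra; exists n, A. Qed.

Lemma measurable_to_bitseqs d (T : measurableType d) (f : T -> bitseqs) :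
  (forall i, measurable_fun setT (fun x => f x i)) -> measurable_fun setT f.
Proof.
move=> mf; apply: (@measurability _ _ T bitseqs _ _ bit_cylinders) => // _ [_ [n [A ->]] <-].
rewrite setTI (_ : _ @^-1` _ = \bigcap_(i < n) ((fun x => f x i) @^-1` A i)).
  by apply: bigcap_measurableType => i _; exact: measurable_preimage.
by apply/seteqP; split => x /=.
Qed.

Lemma measurable_bit_eval i : measurable_fun setT (fun y : bitseqs => y i).
Proof.
apply: (measurable_fun_bool true); rewrite setTI.
rewrite (_ : _ @^-1` _ = bit_cylinder i.+1
  (fun j => if j == i then [set true] else setT)).
  exact: measurable_bit_cylinder.
apply/seteqP; split => y /=; first by move=> yi j _; case: eqP => // ->.
by move=> /(_ i (ltnSn i)); rewrite eqxx.
Qed.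

Definition binary_digits (x : measurableTypeR R) : bitseqs := fun i => bit (iter i (@doubling R) (x : R)).

Lemma measurable_binary_digits : measurable_fun setT binary_digits.
Proof.
apply: measurable_to_bitseqs => i; apply: (measurableT_comp (@measurable_bit R)).
exact: measurable_iter (@measurable_doubling R) i.
Qed.

HB.instance Definition _ := isMeasurableFun.Build _ _ _ _
  binary_digits measurable_binary_digits.

Definition coin_measure : probability bitseqs R := distribution U binary_digits.

Local Notation beta A := (U (@bit R @^-1` A)).

Lemma coin_measure_cylinder n A :
  coin_measure (bit_cylinder n A) = (\prod_(i < n) beta (A i))%E.
Proof.
by rewrite -(@shift_cylinder _ _ (measurableTypeR R) bool R U _ _
  (@measurable_bit R) (@measurable_doubling R) (@bit_doubling R)).
Qed.

(** One bit sequence is split into two independent ones: the odd positions feed a single variable,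
    the even positions are handed on to all later variables. *)
Definition even_bits (y : bitseqs) : bitseqs := fun i => y i.*2.
Definition odd_bits (y : bitseqs) : bitseqs := fun i => y i.*2.+1.

Lemma measurable_even_bits : measurable_fun setT even_bits.
Proof. by apply: measurable_to_bitseqs => i; exact: measurable_bit_eval. Qed.
Lemma measurable_odd_bits : measurable_fun setT odd_bits.
Proof. by apply: measurable_to_bitseqs => i; exact: measurable_bit_eval. Qed.

Lemma bit_cylinder_widen n m A : (n <= m)%N -> bit_cylinder n A =
  bit_cylinder m (fun i => if (i < n)%N then A i else setT).
Proof.
move=> nm; apply/seteqP; split => y Ay i.
  by move=> _; case: ifP => // ilt; exact: Ay.
by move=> ilt; have := Ay i (leq_trans ilt nm); rewrite ilt.
Qed.

Lemma prod_double n (F : nat -> \bar R) :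
  (\prod_(i < n.*2) F i = \prod_(i < n) F i.*2.+1 * \prod_(i < n) F i.*2)%E.
Proof.
elim: n => [|n IHn]; first by rewrite !big_ord0 mule1.
rewrite doubleS !big_ord_recr/= IHn -!muleA; congr (_ * _)%E.
by rewrite [RHS]muleCA [X in (_ * X)%E]muleC !muleA.
Qed.

Lemma coin_measure_even_odd n A B :
  coin_measure (odd_bits @^-1` bit_cylinder n A `&`
                even_bits @^-1` bit_cylinder n B) =
  (\prod_(i < n) beta (A i) * \prod_(i < n) beta (B i))%E.
Proof.
pose C i := if odd i then A i./2 else B i./2.
have -> : odd_bits @^-1` bit_cylinder n A `&`
    even_bits @^-1` bit_cylinder n B = bit_cylinder n.*2 C.
  apply/seteqP; split => y /=.
    move=> [Ay By] i ilt; rewrite /C; have := odd_double_half i.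
    have ih : (i./2 < n)%N by rewrite ltn_half_double.
    case: (odd i) => /= iE; rewrite -[in y i]iE; [exact: Ay|exact: By].
  move=> Cy; split => i ilt.
    have := Cy i.*2.+1; rewrite /C /= odd_double /= uphalf_double; apply.
    by rewrite ltn_Sdouble.
  have := Cy i.*2; rewrite /C /= odd_double /= doubleK; apply.
  by rewrite ltn_double.
rewrite coin_measure_cylinder (prod_double n (fun i => beta (C i))); congr (_ * _)%E.
  by apply: eq_bigr => i _; rewrite /C/= odd_double/= uphalf_double.
by apply: eq_bigr => i _; rewrite /C/= odd_double/= doubleK.
Qed.

Lemma coin_measure_odd n A :
  coin_measure (odd_bits @^-1` bit_cylinder n A) = (\prod_(i < n) beta (A i))%E.
Proof.
have := coin_measure_even_odd n A (fun=> setT).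
rewrite [X in (_ * X)%E]big1 => [|i _]; last by rewrite preimage_setT probability_setT.
rewrite mule1 (_ : bit_cylinder n (fun=> setT) = setT) ?preimage_setT ?setIT//.
by apply/seteqP; split.
Qed.

Lemma coin_measure_even n A :
  coin_measure (even_bits @^-1` bit_cylinder n A) = (\prod_(i < n) beta (A i))%E.
Proof.
have := coin_measure_even_odd n (fun=> setT) A.
rewrite [X in (X * _)%E]big1 => [|i _]; last by rewrite preimage_setT probability_setT.
rewrite mul1e (_ : bit_cylinder n (fun=> setT) = setT) ?preimage_setT ?setTI//.
by apply/seteqP; split.
Qed.

Lemma coin_measure_oddE A : measurable A ->
  coin_measure (odd_bits @^-1` A) = coin_measure A.
Proof.
move=> mA; apply: (@pi_system_unique _ _ _ _ _ bitseqs _ coin_measure coin_measure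
  odd_bits id bit_cylinders) => //.
- exact: measurable_odd_bits.
- by move=> _ [n [B ->]]; exact: measurable_bit_cylinder.
- exact: bit_cylinders_setI.
- exact: bit_cylinders_setT.
- by apply: le_lt_trans (probability_le1 coin_measure measurableT) _; exact: ltry.
- by move=> _ [n [B ->]]; exact: etrans (coin_measure_odd _ _) (esym (coin_measure_cylinder _ _)).
Qed.

Lemma coin_measure_evenE A : measurable A ->
  coin_measure (even_bits @^-1` A) = coin_measure A.
Proof.
move=> mA; apply: (@pi_system_unique _ _ _ _ _ bitseqs _ coin_measure coin_measure
  even_bits id bit_cylinders) => //.
- exact: measurable_even_bits.
- by move=> _ [n [B ->]]; exact: measurable_bit_cylinder.
- exact: bit_cylinders_setI.
- exact: bit_cylinders_setT.
- by apply: le_lt_trans (probability_le1 coin_measure measurableT) _; exact: ltry.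
- by move=> _ [n [B ->]]; exact: etrans (coin_measure_even _ _) (esym (coin_measure_cylinder _ _)).
Qed.

(** The second factor is the measure of [B] itself, not of its preimage: this is the hypothesis [ZD]
    with [even_bits] as the shift. *)
Lemma even_odd_independent A B : measurable A -> measurable B ->
  coin_measure (odd_bits @^-1` A `&` even_bits @^-1` B) =
  (coin_measure (odd_bits @^-1` A) * coin_measure B)%E.
Proof.
move=> mA mB; rewrite -(coin_measure_evenE mB).
apply: (@independent_pi _ _ _ _ bitseqs bitseqs _ coin_measure odd_bits even_bits
  bit_cylinders bit_cylinders) => //.
- exact: measurable_odd_bits.
- exact: measurable_even_bits.
- by move=> _ [n [C ->]]; exact: measurable_bit_cylinder.
- exact: bit_cylinders_setI.
- exact: bit_cylinders_setT.
- by move=> _ [n [C ->]]; exact: measurable_bit_cylinder.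
- exact: bit_cylinders_setI.
- exact: bit_cylinders_setT.
- move=> _ _ [n [C ->]] [m [D ->]].
  rewrite (bit_cylinder_widen C (leq_maxl n m)) (bit_cylinder_widen D (leq_maxr n m)).
  apply: etrans (coin_measure_even_odd _ _ _) _; congr (_ * _)%E.
    exact: esym (coin_measure_odd _ _).
  exact: esym (coin_measure_even _ _).
Qed.

End cantor_measure.

(** * Sampling a law on the line from a uniform variable *)

Section quantile.
Variables (R : realType) (P : probability (measurableTypeR R) R).
Local Notation U := (uniform_prob (@ltr01 R)).

Let idR : measurableTypeR R -> R := idfun.
#[local] HB.instance Definition _ :=
  isMeasurableFun.Build _ _ (measurableTypeR R) R idR (@measurable_id _ _ setT).

Definition distr_fun (t : R) : R := fine (P `]-oo, t]%classic).

Lemma distr_funE t : (distr_fun t)%:E = P `]-oo, t]%classic.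
Proof. by rewrite /distr_fun fineK// fin_num_measure. Qed.

Let distr_cdf t : distr_fun t = fine (cdf (idR : {RV P >-> R}) t).
Proof. by []. Qed.

Lemma distr_fun_ge0 t : 0 <= distr_fun t.
Proof. by rewrite fine_ge0. Qed.

Lemma distr_fun_le1 t : distr_fun t <= 1.
Proof. by rewrite -lee_fin distr_funE probability_le1. Qed.

Lemma distr_fun_le s t : s <= t -> distr_fun s <= distr_fun t.
Proof.
move=> st; rewrite -lee_fin !distr_funE le_measure ?inE//.
exact: subset_itvl.
Qed.

Lemma distr_fun_inf u : 0 < u -> u < 1 -> has_inf [set x | u <= distr_fun x].
Proof.
move=> u0 u1; split.
  have : distr_fun @ +oo%R --> (1 : R).
    exact/fine_cvg/(cvg_cdfy1 (idR : {RV P >-> R})).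
  move=> /cvgrPdist_lt/(_ (1 - u)); rewrite subr_gt0 => /(_ u1)[x [_ xu]].
  exists (x + 1); have /= := xu (x + 1); rewrite ltrDl ltr01 => /(_ isT).
  by move=> /(le_lt_trans (ler_norm _)); lra.
have : distr_fun @ -oo%R --> (0 : R).
  exact/fine_cvg/(cvg_cdfNy0 (idR : {RV P >-> R})).
move=> /cvgrPdist_lt/(_ u u0)[x [_ xu]]; exists x => y /= uy.
rewrite leNgt; apply/negP => yx; have /= := xu y yx.
by rewrite sub0r normrN ger0_norm ?distr_fun_ge0// ltNge uy.
Qed.

(** Outside $]0,1[$ the set may be empty or unbounded below, hence the default; such levels have
    uniform measure zero. *)
Definition quantile (u : R) : R :=
  if 0 < u < 1 then inf [set x | u <= distr_fun x] else 0.

(** Right continuity of the distribution function gives the direct implication: if $F(t)<u$, then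
    $F(x)<u$ for some $x>t$, whereas an infimum at most $t$ leaves some $y<x$ with $u\le F(y)$. *)
Lemma quantile_le u t : 0 < u -> u < 1 -> (quantile u <= t) = (u <= distr_fun t).
Proof.
move=> u0 u1; rewrite /quantile u0 u1/=; apply/idP/idP => [qt|ut]; last first.
  by apply: ge_inf => //; exact: (distr_fun_inf u0 u1).2.
have rc : distr_fun x @[x --> t^'+] --> distr_fun t.
  apply: fine_cvg; rewrite distr_cdf fineK ?fin_num_measure//.
  exact: cdf_right_continuous.
rewrite leNgt; apply/negP => tu.
have [x [xu tx]] : exists x, distr_fun x < u /\ t < x.
  near t^'+ => x; exists x; split; last by near: x; exact: nbhs_right_gt.
  by near: x; exact: (cvgr_lt _ rc).
have [y uy yx] := inf_lt (distr_fun_inf u0 u1).1 (le_lt_trans qt tx).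
by move: xu; rewrite ltNge (le_trans uy (distr_fun_le (ltW yx))).
Unshelve. all: by end_near. Qed.

Lemma uniform01_oo (A : set R) : measurable A ->
  U A = lebesgue_measure (A `&` `]0, 1[).
Proof.
move=> mA; rewrite uniform01E//.
have -> : A `&` `[0, 1] = (A `&` `]0, 1[) `|` (A `&` ([set 0] `|` [set 1])).
  rewrite -setIUr; congr (_ `&` _); apply/seteqP; split => x /=; rewrite !in_itv/=.
    move=> /andP[x0 x1]; have [->|xn0] := eqVneq x 0; first by right; left.
    have [->|xn1] := eqVneq x 1; first by right; right.
    by left; rewrite !lt_neqAle x0 x1 xn1 eq_sym xn0.
  by case=> [/andP[/ltW -> /ltW ->]//|[->|->]]; rewrite lexx ler01.
apply: (@measureU0 _ (measurableTypeR R) _ lebesgue_measure) => //; first exact: measurableI.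
  by apply: measurableI => //; exact: measurableU.
apply: (@subset_measure0 _ (measurableTypeR R) _ lebesgue_measure _ ([set 0] `|` [set 1])) => //.
- by apply: measurableI => //; exact: measurableU.
- exact: measurableU.
- apply: etrans (@measureU0 _ (measurableTypeR R) _ lebesgue_measure [set 0] [set 1] _ _ _) _ => //;
    exact: lebesgue_measure_set1.
Qed.

Lemma measurable_quantile : measurable_fun setT quantile.
Proof.
apply: (measurability _ (measurable_realfun.RGenOInfty.measurableE R)) => // _ [_ [t ->] <-].
rewrite setTI -setCitvl preimage_setC; apply: measurableC.
rewrite [X in measurable X](_ : _ = (`]0, 1[ `&` `]-oo, distr_fun t]) `|`
    (~` `]0, 1[ `&` (if 0 <= t then setT else set0))).
  apply: measurableU; first exact: measurableI.
  by apply: measurableI; [exact: measurableC|case: ifP].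
apply/seteqP; split => u /=; rewrite !in_itv/=.
  have [/andP[u0 u1]|u01] := boolP (0 < u < 1).
    by rewrite quantile_le// => ?; left.
  rewrite /quantile (negbTE u01) => ->; right; split => //.
case=> [[/andP[u0 u1] uF]|[/negP]]; first by rewrite quantile_le.
by rewrite /quantile => /negbTE ->; case: ifP.
Qed.

Lemma quantile_law (B : set R) : measurable B -> U (quantile @^-1` B) = P B.
Proof.
move=> mB; rewrite -[RHS]/(P (id @^-1` B)).
apply: (@real_law_unique _ _ (measurableTypeR R) (measurableTypeR R) R U P quantile id) => //.
- exact: measurable_quantile.
- by apply: etrans (probability_setT U) (esym (probability_setT P)).
- by apply: le_lt_trans (probability_le1 U measurableT) _; exact: ltry.
move=> t; apply: (@etrans _ _ (P `]-oo, t]%classic)); last first.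
  by apply: (congr1 P); apply/seteqP; split => w /=; rewrite in_itv.
have mq : measurable [set w | quantile w <= t].
  rewrite (_ : [set _ | _] = quantile @^-1` `]-oo, t]).
    exact: measurable_preimage measurable_quantile _.
  by apply/seteqP; split => w /=; rewrite in_itv.
apply: etrans (uniform01_oo mq) _; rewrite -distr_funE.
have F0 := distr_fun_ge0 t; have F1 := distr_fun_le1 t.
(* At $F(t)=1$ the levels form $]0,1[$ instead of $]0,F(t)]$. *)
have [F1e|F1n] := eqVneq (distr_fun t) 1.
  rewrite (_ : _ `&` _ = `]0, 1[%classic).
    by rewrite lebesgue_measure_itv/= lte01 F1e oppr0 adde0.
  apply/seteqP; split => u /=; rewrite in_itv/=; first by case.
  by move=> /[dup] u01 /andP[u0 u1]; rewrite quantile_le// F1e (ltW u1).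
rewrite (_ : _ `&` _ = `]0, distr_fun t]%classic).
  rewrite lebesgue_measure_itv/= lte_fin; case: ltgtP F0 => // [_ _|<- _//].
  by rewrite oppr0 adde0.
apply/seteqP; split => u /=; rewrite !in_itv/=.
  by move=> [+ /andP[u0 u1]]; rewrite quantile_le// u0 => ->.
move=> /andP[u0 uF]; have u1 : u < 1 by rewrite (le_lt_trans uF)// lt_neqAle F1n.
by rewrite quantile_le// u0 u1.
Qed.

End quantile.

Section dyadic_value.
Variable R : realType.
Local Notation U := (uniform_prob (@ltr01 R)).
Local Notation bitseqs := (g_sigma_algebraType bit_cylinders).

Definition dyadic_term (y : nat -> bool) (i : nat) : R := (y i)%:R * 2^-1 ^+ i.+1.

Definition dyadic_value (y : nat -> bool) : R := limn (series (dyadic_term y)).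

Lemma cvg_dyadic_series y : cvgn (series (dyadic_term y)).
Proof.
apply: (@series_le_cvg _ _ (geometric 2^-1 2^-1)) => [i|i|i|].
- by rewrite mulr_ge0.
- by rewrite /= mulr_ge0.
- by rewrite /dyadic_term /= exprS ler_piMl ?mulr_ge0//; case: (y i).
- by apply: is_cvg_geometric_series; rewrite ger0_norm// invf_lt1// ltr1n.
Qed.

Lemma measurable_dyadic_value : measurable_fun setT (dyadic_value : bitseqs -> R).
Proof.
apply: (@measurable_fun_cvg _ bitseqs R setT (fun n y => series (dyadic_term y) n)).
  move=> n; rewrite /series/=.
  apply: (@measurable_sum _ bitseqs R setT _ (index_iota 0 n)
     (fun i (y : bitseqs) => dyadic_term y i)) => i.
  apply: measurable_funM => //.
  apply: (@measurableT_comp _ _ _ _ _ _ (fun b : bool => b%:R : R)) => //.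
  exact: measurable_bit_eval.
by move=> y _; exact: cvg_dyadic_series.
Qed.

Lemma doubling_iter01 n (x : R) : 0 <= x <= 1 -> 0 <= iter n (@doubling R) x <= 1.
Proof.
move=> x01; elim: n => // n /andP[]; set z := iter n _ x => z0 z1.
by rewrite /= -/z /doubling /bit; case: (leP 2^-1 z) => /= ?; apply/andP; split; lra.
Qed.

Lemma dyadic_series_digits n (x : R) :
  series (dyadic_term (binary_digits x)) n = x - 2^-1 ^+ n * iter n (@doubling R) x.
Proof.
elim: n => [|n IHn].
  by rewrite /series/= big_geq// expr0 mul1r subrr.
rewrite seriesSr IHn /dyadic_term /binary_digits iterS.
set z := iter n _ x; rewrite /doubling exprSr.
move: ((bit z)%:R) (2^-1 ^+ n) => b p; by field.
Qed.

(** The digits are those produced by [doubling], so dyadic rationals cause no ambiguity: the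
    remainder is $2^{-n}$ times an iterate that stays in $[0,1]$, even for $x=1$. *)
Lemma dyadic_value_digits (x : R) : 0 <= x <= 1 -> dyadic_value (binary_digits x) = x.
Proof.
move=> x01; apply/cvg_lim => //.
apply: (@squeeze_cvgr _ _ _ _ (fun n => x - 2^-1 ^+ n) (fun=> x)).
- near=> n; rewrite dyadic_series_digits.
  have /andP[z0 z1] := doubling_iter01 n x01.
  rewrite lerB// ?ler_piMr ?exprn_ge0// gerBl mulr_ge0// exprn_ge0//.
- rewrite -[X in _ --> X]subr0; apply: cvgB; first exact: cvg_cst.
  by apply: cvg_expr; rewrite ger0_norm// invf_lt1// ltr1n.
- exact: cvg_cst.
Unshelve. all: by end_near. Qed.

Lemma dyadic_value_law (B : set R) : measurable B ->
  coin_measure R (dyadic_value @^-1` B) = U B.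
Proof.
move=> mB; rewrite -[LHS]/(U ((dyadic_value \o @binary_digits R) @^-1` B)).
have mvB : measurable ((dyadic_value \o @binary_digits R) @^-1` B).
  apply: measurable_preimage mB; apply: measurableT_comp measurable_dyadic_value _.
  exact: measurable_binary_digits.
rewrite !uniform01E//; congr lebesgue_measure; apply/seteqP; split => x /= [+ x01];
  move: (x01); rewrite in_itv/= => /dyadic_value_digits xE; by rewrite xE.
Qed.

End dyadic_value.

(** Odd bits are read as a uniform number and sent through the normal quantile; iterating
    [even_bits] lets the variable of index $i$ read exactly the positions $2^i(2j+1)$. *)
Lemma exists_iid_standard_normal (R : realType) :
  exists (d : measure_display) (Omega : measurableType d) (P : probability Omega R)
    (w : nat -> Omega -> R),
    (forall i, standard_normal P (w i)) /\ mutually_independent P w.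
Proof.
pose bitseqs := g_sigma_algebraType bit_cylinders.
pose N01 := normal_prob 0 1 : probability (measurableTypeR R) R.
pose Z (y : bitseqs) : R := quantile N01 (dyadic_value R (odd_bits y)).
have mZ : measurable_fun setT Z.
  apply: (measurableT_comp (@measurable_quantile R N01)).
  exact: measurableT_comp (@measurable_dyadic_value R) measurable_odd_bits.
have ZN B : measurable B -> coin_measure R (Z @^-1` B) = N01 B.
  move=> mB; have mqB := measurable_preimage (@measurable_quantile R N01) mB.
  have mvB := measurable_preimage (@measurable_dyadic_value R) mqB.
  exact: etrans (coin_measure_oddE R mvB)
    (etrans (dyadic_value_law mqB) (quantile_law N01 mB)).
have Zind A C : measurable A -> measurable C -> coin_measure R (Z @^-1` A `&` even_bits @^-1` C) =
    (coin_measure R (Z @^-1` A) * coin_measure R C)%E.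
  move=> mA mC.
  have mvA := measurable_preimage (@measurable_dyadic_value R)
    (measurable_preimage (@measurable_quantile R N01) mA).
  exact: (even_odd_independent R mvA mC).
exists _, bitseqs, (coin_measure R), (fun i => Z \o iter i even_bits); split.
  move=> i; have mi := measurable_iter measurable_even_bits i.
  split; first exact: measurableT_comp mZ mi.
  move=> B mB; apply: etrans (ZN B mB).
  exact: (shift_preserving measurable_even_bits Zind i (measurable_preimage mZ mB)).
exact: shift_independent mZ measurable_even_bits Zind.
Qed.

(** * Rescaling one coordinate *)

Section null_sets.
Local Open Scope ereal_scope.

Lemma ae_null_sub d (T : measurableType d) (R : realType)
    (m1 m2 : {measure set T -> \bar R}) (Q : T -> Prop) :
  (forall A, measurable A -> m1 A = 0 -> m2 A = 0) ->
  {ae m1, forall x, Q x} -> {ae m2, forall x, Q x}.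
Proof. by move=> m12 [A [mA A0 QA]]; exists A; split => //; exact: m12. Qed.

(** A set is null for a product exactly when almost every section is null, a condition that sees the
    first factor only through its null sets. *)
Lemma product_null_sub d1 d2 (T1 : measurableType d1) (T2 : measurableType d2)
    (R : realType) (m1 m2 : probability T1 R) (P : probability T2 R) :
  (forall A, measurable A -> m1 A = 0 -> m2 A = 0) ->
  forall A, measurable A -> (m1 \x P) A = 0 -> (m2 \x P) A = 0.
Proof.
move=> m12 A mA; rewrite /product_measure1/=.
have mf := measurable_fun_xsection P mA.
have E (m : probability T1 R) : \int[m]_x (P \o xsection A) x =
    \int[m]_x `|(P \o xsection A) x|.
  by apply: eq_integral => x _; rewrite gee0_abs//=.
rewrite !E => /(ae_eq_integral_abs m1 measurableT mf) h.
by apply/(ae_eq_integral_abs m2 measurableT mf); exact: ae_null_sub h.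
Qed.

(** The normal density vanishes nowhere, so a zero integral over [A] leaves [A] no Lebesgue mass. *)
Lemma normal_null_lebesgue (R : realType) (A : set R) : measurable A ->
  normal_prob 0 1 A = 0 -> (@lebesgue_measure R) A = 0.
Proof.
move=> mA; rewrite /normal_prob => h.
have mf : measurable_fun A (fun x : R => (normal_pdf 0 1 x)%:E).
  by apply/measurable_EFinP; apply: measurable_funTS; exact: measurable_normal_pdf.
have : \int[lebesgue_measure]_(x in A) `|(normal_pdf 0 1 x)%:E| = 0.
  by rewrite -[RHS]h; apply: eq_integral => x _; rewrite gee0_abs// lee_fin normal_pdf_ge0.
move=> /(ae_eq_integral_abs lebesgue_measure mA mf) [B [mB B0 AB]].
apply: (@subset_measure0 _ (measurableTypeR R) _ lebesgue_measure A B) => //.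
move=> x Ax; apply: AB => /= /(_ Ax) /eqP.
rewrite eqe normal_pdfE ?oner_eq0// mulf_eq0 gt_eqF ?normal_peak_gt0 ?oner_eq0//=.
by rewrite /normal_fun gt_eqF ?expR_gt0.
Qed.

Lemma lebesgue_scale (R : realType) (c : R) (c0 : (0 < c)%R) (A : set R) :
  measurable A ->
  lebesgue_measure ((fun x : R => c * x)%R @^-1` A) = (c^-1)%:E * lebesgue_measure A.
Proof.
move=> mA; have mc : measurable_fun [set: R] (fun x : R => c * x)%R.
  exact: measurable_funM.
have c10 : (0 <= c)%R by exact: ltW.
pose m : {measure set (measurableTypeR R) -> \bar R} := mscale (NngNum c10)
  (@measure_function_pushforward__canonical__measure_function_Measure
    _ _ (measurableTypeR R) (measurableTypeR R) _ lebesgue_measure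
    (fun x : R => c * x)%R mc).
have mE B : m B = c%:E * lebesgue_measure ((fun x : R => c * x)%R @^-1` B) by [].
have := @lebesgue_measure_unique R m _ A mA; rewrite mE => -> //; last first.
  move=> _ [[a b] _ <-]; rewrite mE.
  rewrite (_ : _ @^-1` _ = `]c^-1 * a, c^-1 * b]%classic)%R; last first.
    apply/seteqP; split => x /=; rewrite !in_itv/= ltr_pdivrMl// ler_pdivlMl//.
  rewrite !lebesgue_measure_itv/= !lte_fin ltr_pM2l ?invr_gt0//.
  case: ifP => _; last by rewrite mule0.
  by rewrite -!EFinD -EFinM; congr EFin; rewrite mulrBr !mulVKf ?gt_eqF.
by rewrite muleA -EFinM mulVf ?gt_eqF// mul1e.
Qed.

End null_sets.

(** The new real factor carries coordinate 0 alone, so that its law can be changed without touching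
    the other coordinates. *)
Lemma iid_cons d (Omega : measurableType d) (R : realType)
    (P : probability Omega R) (w : nat -> Omega -> R)
    (m : probability (measurableTypeR R) R) (Z : R -> R) :
  (forall i, standard_normal P (w i)) -> mutually_independent P w ->
  standard_normal m (Z : measurableTypeR R -> R) ->
  let zeta i (x : measurableTypeR R * Omega) :=
    if i is j.+1 then w j x.2 else Z x.1 in
  (forall i, standard_normal (m \x P)%E (zeta i)) /\
  mutually_independent (m \x P)%E zeta.
Proof.
move=> wN wI [mZ ZN] zeta.
have mw i B : measurable B -> measurable (w i @^-1` B).
  by move=> mB; exact: measurable_preimage (wN i).1 mB.
have rectE A B : measurable A -> measurable B ->
    ((m \x P) ((fst @^-1` A) `&` (snd @^-1` B)) = m A * P B)%E.
  by move=> mA mB; rewrite -product_measure1E.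
have sndE B : measurable B -> ((m \x P) (snd @^-1` B) = P B)%E.
  by move=> mB; have := rectE setT B measurableT mB;
    rewrite preimage_setT setTI probability_setT mul1e.
have fstE A : measurable A -> ((m \x P) (fst @^-1` A) = m A)%E.
  by move=> mA; have := rectE A setT mA measurableT;
    rewrite preimage_setT setIT probability_setT mule1.
have zN i : standard_normal (m \x P)%E (zeta i).
  case: i => [|i]; split.
  - exact: (measurableT_comp mZ (@measurable_fst _ _ (measurableTypeR R) Omega)).
  - move=> B mB; rewrite -(ZN _ mB) -[RHS]fstE//.
    exact: (@measurable_preimage _ _ (measurableTypeR R) R).
  - exact: (measurableT_comp (wN i).1 (@measurable_snd _ _ (measurableTypeR R) Omega)).
  - move=> B mB; rewrite -((wN i).2 _ mB) -[RHS]sndE//; exact: mw.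
split => // J B uJ mB.
(* Positive indices move down by one; index 0 contributes the constraint [A0] when it occurs in
   [J]. *)
pose J' := [seq j.-1 | j <- J & j != 0%N].
pose B' j := B j.+1.
have uJ' : uniq J'.
  rewrite map_inj_in_uniq ?filter_uniq// => i j; rewrite !mem_filter.
  by case: i => // i; case: j => // j _ _ /= ->.
have J'P j : (j \in J') = (j.+1 \in J).
  apply/mapP/idP => [[[|i]]|jJ]; rewrite ?mem_filter//; first by move=> /andP[_ iJ] ->.
  by exists j.+1; rewrite ?mem_filter.
pose A0 : set R := if 0%N \in J then Z @^-1` B 0%N else setT.
have mA0 : measurable (A0 : set (measurableTypeR R)).
  rewrite /A0; case: ifP => // _.
  exact: (@measurable_preimage _ _ (measurableTypeR R) R).
have mJ' : measurable (\bigcap_(j in [set` J']) (w j @^-1` B' j)).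
  by apply: bigcap_measurableType => j _; exact: (mw _ _ (mB j.+1)).
have -> : \bigcap_(j in [set` J]) (zeta j @^-1` B j) =
    fst @^-1` A0 `&` snd @^-1` (\bigcap_(j in [set` J']) (w j @^-1` B' j)).
  apply/seteqP; split => x /=.
    move=> Jx; split; first by rewrite /A0; case: ifP => // /(Jx 0%N).
    by move=> j /=; rewrite J'P => /Jx.
  move=> [A0x Jx] [|j] /= jJ; first by move: A0x; rewrite /A0 jJ.
  by apply: Jx; rewrite /= J'P.
apply: etrans (rectE _ _ mA0 mJ') _; rewrite wI; [|exact: uJ'|by move=> j; exact: mB].
have zE j : ((m \x P) (zeta j.+1 @^-1` B j.+1) = P (w j @^-1` B' j))%E.
  by rewrite -sndE//; exact: (mw _ _ (mB j.+1)).
rewrite [RHS](bigID (fun j => j == 0%N))/=; congr (_ * _)%E.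
  rewrite /A0; case: ifPn => [J0|J0].
    rewrite -big_filter (filter_pred1_uniq uJ J0) big_seq1.
    by rewrite -fstE//; exact: (@measurable_preimage _ _ (measurableTypeR R) R).
  rewrite probability_setT big_seq_cond big1// => i /andP[iJ /eqP i0].
  by move: J0; rewrite -i0 iJ.
rewrite /J' big_map big_filter; apply: eq_bigr => -[//|j] _.
by rewrite zE.
Qed.

(** The probabilities differ in the real factor only: N(0,1) against its image under multiplication
    by [c], under which [c^-1] times the coordinate is standard. *)
Lemma exists_iid_rescaled (R : realType) (c : R) : 0 < c ->
  exists (d : measure_display) (Omega : measurableType d)
    (P1 P2 : probability Omega R) (w : nat -> Omega -> R),
    [/\ (forall i, standard_normal P1 (w i)) /\ mutually_independent P1 w,
       let w' i x := if i == 0%N then c^-1 * w 0%N x else w i x in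
       (forall i, standard_normal P2 (w' i)) /\ mutually_independent P2 w' &
       forall A, measurable A -> P1 A = 0%E <-> P2 A = 0%E].
Proof.
move=> c0; have [dO [ Omega [P [w []]]]] := exists_iid_standard_normal R; move=> wN wI.
pose N01 := normal_prob 0 1 : probability (measurableTypeR R) R.
pose sc (x : measurableTypeR R) : measurableTypeR R := c * (x : R).
have msc : measurable_fun setT sc by exact: measurable_funM.
pose scM : {mfun measurableTypeR R >-> measurableTypeR R} :=
  HB.pack sc (isMeasurableFun.Build _ _ _ _ sc msc).
pose m2 : probability (measurableTypeR R) R := distribution N01 scM.
have m2E B : m2 B = N01 (sc @^-1` B) by [].
have idN : standard_normal N01 (idfun : measurableTypeR R -> R).
  by split => //; exact: measurable_id.
have scN : standard_normal m2 ((fun x : R => c^-1 * x) : measurableTypeR R -> R).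
  split; first exact: measurable_funM.
  move=> B mB; rewrite m2E; congr (normal_prob _ _ _).
  by apply/seteqP; split => x /=; rewrite /sc mulKf ?gt_eqF.
(* Both implications pass through Lebesgue measure, whose null sets are stable under dilation. *)
have N2 A : measurable A -> N01 A = 0%E <-> m2 A = 0%E.
  move=> mA; rewrite m2E; have mcA := measurable_preimage msc mA.
  have lN B : measurable B -> (@lebesgue_measure R) B = 0%E -> N01 B = 0%E.
    move=> mB B0; apply: (@normal_prob_dominates R 0 1 B) => // D mD DB.
    exact: (@subset_measure0 _ (measurableTypeR R) _ lebesgue_measure D B).
  split => /normal_null_lebesgue h; apply: lN => //.
    by rewrite [LHS](lebesgue_scale c0)// h// mule0.
  move: (h mcA); rewrite (lebesgue_scale c0)// => /eqP.
  by rewrite mule_eq0 eqe invr_eq0 gt_eqF//= => /eqP.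
exists _, (measurableTypeR R * Omega)%type, (N01 \x P)%E, (m2 \x P)%E.
exists (fun i x => if i is j.+1 then w j x.2 else x.1); split.
- exact: iid_cons wN wI idN.
- pose z1 i (x : measurableTypeR R * Omega) : R :=
    if i is j.+1 then w j x.2 else c^-1 * x.1.
  pose z2 i (x : measurableTypeR R * Omega) : R :=
    if i == 0%N then c^-1 * x.1 else if i is j.+1 then w j x.2 else x.1.
  have z12 : z2 = z1 by apply/funext => -[|i]; apply/funext => x.
  change ((forall i, standard_normal (m2 \x P)%E (z2 i)) /\
    mutually_independent (m2 \x P)%E z2).
  rewrite z12; exact: iid_cons wN wI scN.
- move=> A mA; split.
    exact: (product_null_sub (fun B mB => (N2 B mB).1) mA).
  exact: (product_null_sub (fun B mB => (N2 B mB).2) mA).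
Qed.

(** * Riesz representation and orthonormal bases *)

Section dot_product.
Context {R : realType} {H : completeNormedModType R}.
Variable dot : {dot H for (@idfun R)}.
Implicit Types x y z : H.

Lemma dotC x y : dot x y = dot y x.
Proof. by rewrite hermC expr0 mul1r. Qed.
Lemma dotDl x y z : dot (x + y) z = dot x z + dot y z.
Proof. exact: linearDl. Qed.
Lemma dotDr x y z : dot z (x + y) = dot z x + dot z y.
Proof. exact: linearDr. Qed.
Lemma dotZl a x z : dot (a *: x) z = a * dot x z.
Proof. exact: linearZl_LR. Qed.
Lemma dotZr a x z : dot z (a *: x) = a * dot z x.
Proof. exact: linearZr_LR. Qed.
Lemma dotNl x z : dot (- x) z = - dot x z.
Proof. exact: linearNl. Qed.
Lemma dotNr x z : dot z (- x) = - dot z x.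
Proof. exact: linearNr. Qed.
Lemma dotBl x y z : dot (x - y) z = dot x z - dot y z.
Proof. by rewrite dotDl dotNl. Qed.
Lemma dotBr x y z : dot z (x - y) = dot z x - dot z y.
Proof. by rewrite dotDr dotNr. Qed.
Lemma dot0l z : dot 0 z = 0.
Proof. exact: linear0l. Qed.
Lemma dot0r z : dot z 0 = 0.
Proof. exact: linear0r. Qed.
Lemma dot_suml I (r : seq I) (Q : pred I) (F : I -> H) z :
  dot (\sum_(i <- r | Q i) F i) z = \sum_(i <- r | Q i) dot (F i) z.
Proof. exact: linear_sumlz. Qed.
Lemma dot_sumr I (r : seq I) (Q : pred I) (F : I -> H) z :
  dot z (\sum_(i <- r | Q i) F i) = \sum_(i <- r | Q i) dot z (F i).
Proof. exact: linear_sumr. Qed.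

Hypothesis dot_norm : hilbert_norm dot.

Lemma normD_sqr x y : `|x + y| ^+ 2 = `|x| ^+ 2 + 2 * dot x y + `|y| ^+ 2.
Proof. by rewrite -!dot_norm dotDl !dotDr (dotC y x); ring. Qed.

Lemma dot_le x y : dot x y <= `|x| * `|y|.
Proof.
have : `|x + y| ^+ 2 <= (`|x| + `|y|) ^+ 2.
  by rewrite ler_pXn2r// ?nnegrE ?addr_ge0// ler_normD.
by rewrite normD_sqr; lra.
Qed.

Lemma dot_norm_le x y : `|dot x y| <= `|x| * `|y|.
Proof. by rewrite ler_norml dot_le lerNl -dotNl (le_trans (dot_le _ _))// normrN. Qed.

Lemma cvg_dotl I (F : set_system I) {FF : Filter F} (f : I -> H) x y :
  f i @[i --> F] --> y -> dot (f i) x @[i --> F] --> dot y x.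
Proof.
move=> fy; apply/cvgrPdist_le => e e0.
have x1 : 0 < `|x| + 1 by rewrite ltr_wpDl.
have := @cvgr_dist_le _ _ _ _ _ f y fy (e / (`|x| + 1)); rewrite divr_gt0// => /(_ FF isT).
apply: filterS => i yi; rewrite -dotBl (le_trans (dot_norm_le _ _))//.
rewrite (le_trans (ler_wpM2r _ yi))//.
by rewrite mulrAC ler_pdivrMr// ler_pM2l// lerDl.
Qed.

(* Minimising |x|^2 - 2c over a linear graph G bounded by |c| <= C |x| gives a
   vector representing x |-> c: this covers at once the Riesz theorem and the
   extension of bounded functionals from non-closed subspaces. *)
Lemma riesz_graph (G : set (H * R)) (C : R) :
  G (0, 0) -> (forall p q, G p -> G q -> G (p.1 + q.1, p.2 + q.2)) ->
  (forall a p, G p -> G (a *: p.1, a * p.2)) ->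
  (forall p, G p -> `|p.2| <= C * `|p.1|) ->
  exists y, forall p, G p -> dot y p.1 = p.2.
Proof.
move=> G0 GD GZ GC.
pose J (p : H * R) := `|p.1| ^+ 2 - 2 * p.2.
have J_ge p : G p -> - C ^+ 2 <= J p.
  move=> /GC pC; rewrite /J; have : p.2 <= C * `|p.1| by exact: le_trans (ler_norm _) pC.
  by move=> ?; have := sqr_ge0 (`|p.1| - C); lra.
have infJ : has_inf (J @` G).
  by split; [exists (J (0, 0)), (0, 0)|exists (- C ^+ 2) => _ [p Gp <-]; exact: J_ge].
pose m := inf (J @` G).
have m_le p : G p -> m <= J p by move=> Gp; apply: ge_inf; [exact: infJ.2|exists p].
have /choice[p pP] n : exists p, G p /\ J p < m + harmonic n.
  have [_ [q Gq <-] qm] := inf_adherent (harmonic_gt0 n) infJ.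
  by exists q.
have Gp n : G (p n) by case: (pP n).
have Jp n : J (p n) < m + harmonic n by case: (pP n).
(* Parallelogram identity: the value of [J] at the midpoint is still at least [m], so two
   near-minimisers are close. *)
have mid n k : `|(p n).1 - (p k).1| ^+ 2 <= 2 * (harmonic n + harmonic k).
  have := m_le _ (GZ 2^-1 _ (GD _ _ (Gp n) (Gp k))).
  have := Jp n; have := Jp k; rewrite /J/=.
  rewrite -!dot_norm dotZl dotZr !(dotDl, dotDr, dotNl, dotNr) (dotC (p k).1 (p n).1).
  move: (dot (p n).1 (p n).1) (dot (p n).1 (p k).1) (dot (p k).1 (p k).1) => a b c.
  by rewrite /harmonic /=; move: (p n).2 (p k).2 n.+1%:R^-1 k.+1%:R^-1 => u v s t; lra.
have /cauchy_cvg : cauchy ((fun n => (p n).1) @ \oo).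
  apply: cauchy_exP => e e0.
  have e24 : 0 < e ^+ 2 / 4 by rewrite divr_gt0// exprn_gt0.
  have hn : \forall n \near \oo, harmonic n < e ^+ 2 / 4 :> R.
    have /cvgr_dist_lt/(_ _ e24) := @cvg_harmonic R.
    by apply: filterS => n; rewrite sub0r normrN ger0_norm ?harmonic_ge0.
  have [N _ NP] := hn; exists (p N).1; exists N => // n /= Nn.
  rewrite -ball_normE/= -(@ltr_pXn2r _ 2)// ?nnegrE ?(ltW e0)//.
  rewrite (le_lt_trans (mid _ _))//.
  by have := NP N (leqnn N); have := NP n Nn; lra.
move=> /cvg_ex[y py]; exists y => -[x c] Gxc /=.
(* The graph need not be closed, so [y] need not be a first component of it. Minimality is used at
   [p n] shifted by $t(x,c)$ and then passed to the limit. *)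
have key t : 0 <= 2 * t * (dot y x - c) + t ^+ 2 * `|x| ^+ 2.
  have cv : 2 * t * (dot (p n).1 x - c) + t ^+ 2 * `|x| ^+ 2 + harmonic n @[n --> \oo] -->
      2 * t * (dot y x - c) + t ^+ 2 * `|x| ^+ 2 + 0.
    apply: cvgD; last exact: cvg_harmonic.
    apply: cvgD; last exact: cvg_cst.
    apply: cvgM; first exact: cvg_cst.
    by apply: cvgB; [exact: cvg_dotl|exact: cvg_cst].
  rewrite -[leRHS]addr0; apply: (cvgr_to_ge cv).
  near=> n; have := m_le _ (GD _ _ (Gp n) (GZ t _ Gxc)); have := Jp n.
  rewrite /J/= normD_sqr dotZr normrZ exprMn real_normK ?num_real//.
  by rewrite /harmonic /=; move: (n.+1%:R^-1) => h; lra.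
(* With $\delta=\langle y,x\rangle-c$, the quadratic $2t\delta+t^2|x|^2$ is nonnegative in $t$. The
   choice $t=-\delta$ if $|x|=0$, and the minimiser $-\delta/|x|^2$ otherwise, forces $\delta=0$. *)
have [x0|x0] := eqVneq `|x| 0.
  have := key (- (dot y x - c)); rewrite x0 expr0n mulr0 addr0.
  rewrite mulrN mulNr oppr_ge0 -mulrA -expr2 pmulr_rle0// => h.
  by apply/eqP; rewrite -subr_eq0 -sqrf_eq0 eq_le h sqr_ge0.
have x2 : 0 < `|x| ^+ 2 by rewrite exprn_gt0// lt_neqAle eq_sym x0/=.
have := key (- (dot y x - c) / `|x| ^+ 2).
rewrite (_ : _ + _ = - ((dot y x - c) ^+ 2 / `|x| ^+ 2)); last by field.
rewrite oppr_ge0 pmulr_lle0 ?invr_gt0// => h.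
by apply/eqP; rewrite -subr_eq0 -sqrf_eq0 eq_le h sqr_ge0.
Unshelve. all: by end_near. Qed.

Lemma riesz (f : {linear H -> R}) : continuous f ->
  exists y, forall x, f x = dot y x.
Proof.
move=> cf; have /linear_boundedP hf := continuous_linear_bounded (0 : H) (cf 0).
near +oo_R => C; have fC : forall x, `|f x| <= C * `|x| by near: C.
have [|p q /= -> ->|a p /= ->|p /= ->//|y yf] :=
    @riesz_graph [set p | p.2 = f p.1] C.
- by rewrite /= linear0.
- by rewrite linearD.
- by rewrite linearZ.
- by exists y => x; rewrite (yf (x, f x)).
Unshelve. all: by end_near. Qed.

End dot_product.

(** * Gram-Schmidt for sequences with dependent vectors *)

Section gram_schmidt.
Context {R : realType} {H : completeNormedModType R}.
Variable dot : {dot H for (@idfun R)}.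
Hypothesis dot_norm : hilbert_norm dot.

Definition finite_span (h : nat -> H) : set H :=
  [set x : H | exists n (c : nat -> R), x = \sum_(i < n) c i *: h i].

Lemma finite_span0 h : finite_span h 0.
Proof. by exists 0%N, (fun=> 0); rewrite big_ord0. Qed.

Lemma finite_span_base h i : finite_span h (h i).
Proof.
exists i.+1, (fun j => (j == i)%:R); rewrite (bigD1 ord_max)//= eqxx scale1r.
rewrite big1 ?addr0// => j ji; rewrite (_ : (j : nat) == i = false) ?scale0r//.
by apply/negP => /eqP e; move/negP: ji; apply; apply/eqP/val_inj.
Qed.

Lemma finite_spanZ h a x : finite_span h x -> finite_span h (a *: x).
Proof.
move=> [n [c ->]]; exists n, (fun i => a * c i); rewrite scaler_sumr.
by apply: eq_bigr => i _; rewrite scalerA.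
Qed.

Lemma finite_spanD h x y : finite_span h x -> finite_span h y -> finite_span h (x + y).
Proof.
have widen n m (c : nat -> R) : (n <= m)%N -> \sum_(i < n) c i *: h i =
    \sum_(i < m) (if (i < n)%N then c i else 0) *: h i.
  move=> nm; rewrite -(big_mkord xpredT (fun i => c i *: h i)).
  rewrite -(big_mkord xpredT (fun i => (if (i < n)%N then c i else 0) *: h i)).
  rewrite (@big_cat_nat _ _ _ n 0 m)//= [X in _ = _ + X]big_nat_cond [X in _ = _ + X]big1.
    by rewrite addr0; apply: eq_big_nat => i /= ->.
  by move=> i /andP[/andP[ni _] _]; rewrite ltnNge ni scale0r.
move=> [n [c ->]] [m [d ->]]; exists (maxn n m).
exists (fun i => (if (i < n)%N then c i else 0) + (if (i < m)%N then d i else 0)).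
rewrite (widen _ _ c (leq_maxl n m)) (widen _ _ d (leq_maxr n m)) -big_split/=.
by apply: eq_bigr => i _; rewrite scalerDl.
Qed.

Lemma finite_span_sum h I (r : seq I) (F : I -> H) :
  (forall i, finite_span h (F i)) -> finite_span h (\sum_(i <- r) F i).
Proof.
move=> hF; elim: r => [|i r IH]; first by rewrite big_nil; exact: finite_span0.
by rewrite big_cons; exact: finite_spanD.
Qed.

Lemma finite_span_trans g h x :
  (forall i, finite_span g (h i)) -> finite_span h x -> finite_span g x.
Proof.
by move=> gh [n [c ->]]; apply: finite_span_sum => i; exact: finite_spanZ.
Qed.

Lemma dense_sub (A B : set H) : A `<=` B -> dense A -> dense B.
Proof. by move=> AB dA O O0 oO; have [x [Ox /AB Bx]] := dA O O0 oO; exists x. Qed.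

Lemma orthonormal_basis_change (D : set nat) g h :
  D = setT \/ (exists m, D = `I_m) -> orthonormal_on dot D g ->
  (forall i, finite_span g (h i)) -> orthonormal_basis dot h ->
  orthonormal_basis dot g.
Proof.
move=> DE og gh [D' [_ _ dh]]; exists D; split => //.
by apply: dense_sub dh => x; exact: finite_span_trans.
Qed.

Local Notation is_on l := (forall i j, (i < size l)%N -> (j < size l)%N ->
  dot (nth 0 l i) (nth 0 l j) = (i == j)%:R).

Definition residual (l : seq H) (v : H) : H := v - \sum_(g <- l) dot g v *: g.

Lemma residual_rcons l g v : residual (rcons l g) v = residual l v - dot g v *: g.
Proof. by rewrite /residual -cats1 big_cat/= big_seq1 opprD addrA. Qed.

Lemma residual_orthogonal (l : seq H) v i : is_on l -> (i < size l)%N ->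
  dot (nth 0 l i) (residual l v) = 0.
Proof.
move=> ol il; rewrite /residual dotBr dot_sumr (big_nth 0) big_mkord.
rewrite (bigD1 (Ordinal il))//= dotZr ol// eqxx mulr1 big1 ?addr0 ?subrr//.
move=> j ji; rewrite dotZr ol// (_ : i == j = false) ?mulr0//.
by apply/negP => /eqP e; move/negP: ji; apply; apply/eqP/val_inj.
Qed.

Variable x : nat -> H.

(** The first nonzero residual is normalised and appended; if there is none the list stays.
    Dependent vectors are thus skipped without leaving gaps, as the index set of an
    [orthonormal_basis] is everything or an initial segment. *)
Definition gs_step (l : seq H) : seq H :=
  if pselect (exists k, residual l (x k) != 0) is left ex then
    let r := residual l (x (ex_minn ex)) in rcons l (`|r|^-1 *: r)
  else l.

Lemma gs_stepP l : is_on l ->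
  (gs_step l = l /\ forall k, residual l (x k) = 0) \/
  exists k, [/\ residual l (x k) != 0, (forall j, (j < k)%N -> residual l (x j) = 0),
    gs_step l = rcons l (`|residual l (x k)|^-1 *: residual l (x k)),
    is_on (gs_step l) & forall j, (j <= k)%N -> residual (gs_step l) (x j) = 0].
Proof.
move=> ol; rewrite /gs_step; case: pselect => [ex|nex]; last first.
  left; split => // k; apply/eqP; apply: contra_notT nex => rk.
  by exists k.
right; case: ex_minnP => k rk kmin; exists k.
have small j : (j < k)%N -> residual l (x j) = 0.
  by move=> jk; apply/eqP; apply: contraTT jk => /kmin; rewrite -leqNgt.
set r := residual l (x k) in rk *.
set g := `|r|^-1 *: r.
have r0 : `|r| != 0 by rewrite normr_eq0.
have gl i : (i < size l)%N -> dot (nth 0 l i) g = 0.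
  by move=> il; rewrite /g dotZr residual_orthogonal// mulr0.
have gg : dot g g = 1.
  by rewrite /g dotZl dotZr dot_norm expr2 mulKf// mulVf.
have gsum v : dot g (\sum_(h <- l) dot h v *: h) = 0.
  rewrite dot_sumr (big_nth 0) big_mkord big1// => i _.
  by rewrite dotZr (dotC _ g) gl ?mulr0.
split => //.
  move=> i j; rewrite size_rcons !ltnS (leq_eqVlt i) (leq_eqVlt j).
  move=> /orP[/eqP->|il] /orP[/eqP->|jl];
    rewrite !nth_rcons ?ltnn ?eqxx ?il ?jl/=.
  - by rewrite gg.
  - by rewrite dotC gl// gtn_eqF.
  - by rewrite gl// ltn_eqF.
  - exact: ol.
move=> j; rewrite leq_eqVlt residual_rcons => /orP[/eqP->|jk].
  have gx : dot g (x k) = `|r|.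
    have : dot g r = `|r| by rewrite /g dotZl dot_norm expr2 mulKf.
    by rewrite {1}/r /residual dotBr gsum subr0.
  by rewrite -/r gx /g scalerA mulfV// scale1r subrr.
have xj : x j = \sum_(h <- l) dot h (x j) *: h.
  by apply/eqP; rewrite -subr_eq0; apply/eqP; exact: small.
by rewrite small// {1}xj gsum scale0r subrr.
Qed.

Definition gs n := iter n gs_step [::].

Lemma gs_on n : is_on (gs n).
Proof.
elim: n => [//|n IHn]; have [[e _]|[k [_ _ _ //]]] := gs_stepP IHn.
by rewrite /= e.
Qed.

(** Each step disposes of the least index not yet spanned, so $n$ steps take care of all indices
    below $n$. *)
Lemma gs_residual n k : (k < n)%N -> residual (gs n) (x k) = 0.
Proof.
elim: n k => [//|n IHn] k kn /=; have [[-> //]|[j [rj small _ _ ok]]] := gs_stepP (@gs_on n).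
apply: ok; rewrite leqNgt; apply/negP => jk; move/eqP: rj; apply.
by apply: IHn; exact: leq_trans jk kn.
Qed.

Lemma gs_nth n i : (i < size (gs n))%N -> nth 0 (gs n.+1) i = nth 0 (gs n) i.
Proof.
move=> il /=; have [[-> //]|[k [_ _ -> _ _]]] := gs_stepP (@gs_on n).
by rewrite nth_rcons il.
Qed.

Lemma gs_size n : (size (gs n) <= n)%N.
Proof.
elim: n => [//|n IHn] /=; have [[-> _]|[k [_ _ -> _ _]]] := gs_stepP (@gs_on n).
  exact: leqW.
by rewrite size_rcons.
Qed.

Lemma gs_size_stuck n : size (gs n) = n \/ gs n.+1 = gs n.
Proof.
elim: n => [|n [sn|e]]; [by left| |by right; rewrite -[LHS]/(gs_step (gs n.+1)) e].
have [[e _]|[k [_ _ e _ _]]] := gs_stepP (@gs_on n).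
  by right; rewrite -[LHS]/(gs_step (gs_step (gs n))) e.
by left; rewrite -[gs n.+1]/(gs_step (gs n)) e size_rcons sn.
Qed.

Lemma gs_size_mono n m : (n <= m)%N -> (size (gs n) <= size (gs m))%N.
Proof.
move=> /subnKC <-; elim: (m - n)%N => [|k IHk]; first by rewrite addn0.
rewrite addnS (leq_trans IHk)//=; have [[-> //]|[j [_ _ -> _ _]]] := gs_stepP (@gs_on (n + k)).
by rewrite size_rcons.
Qed.

(** The default of [nth] supplies the zero padding when the process stops early. *)
Definition gs_basis i := nth 0 (gs i.+1) i.

Lemma gs_basisE n i : (i < size (gs n))%N -> nth 0 (gs n) i = gs_basis i.
Proof.
move=> il; have : (i < n)%N := leq_trans il (gs_size n).
elim: n il => // n IHn il; rewrite ltnS leq_eqVlt => /orP[/eqP -> //|ilt].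
have [iln|lni] := ltnP i (size (gs n)); first by rewrite gs_nth// IHn.
have [sn|e] := gs_size_stuck n; first by move: lni; rewrite sn leqNgt ilt.
by move: il; rewrite e ltnNge lni.
Qed.

Lemma gs_basis_orthonormal : exists D : set nat,
  (D = setT \/ exists m, D = `I_m) /\ orthonormal_on dot D gs_basis.
Proof.
have [full|] := pselect (forall n, size (gs n) = n).
  exists setT; split; first by left.
  split => [i j _ _|i /(_ Logic.I)//].
  have ig : (i < size (gs (maxn i j).+1))%N by rewrite full ltnS leq_maxl.
  have jg : (j < size (gs (maxn i j).+1))%N by rewrite full ltnS leq_maxr.
  by rewrite -(gs_basisE ig) -(gs_basisE jg) gs_on.
move=> /existsNP[n sn]; exists `I_(size (gs n)); split; first by right; exists (size (gs n)).
have en : gs n.+1 = gs n by have [] := gs_size_stuck n.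
have stuck k : gs (n + k) = gs n.
  elim: k => [|k IHk]; first by rewrite addn0.
  by rewrite addnS /= IHk.
split=> [i j /= ig jg|i /= /negP].
  by rewrite -(gs_basisE ig) -(gs_basisE jg) gs_on.
rewrite -leqNgt => ni; rewrite /gs_basis nth_default//.
have [le|/ltnW lt] := leqP n i.+1; first by rewrite -(subnKC le) stuck (leq_trans ni).
exact: leq_trans (gs_size_mono lt) ni.
Qed.

Lemma gs_basis_span k : finite_span gs_basis (x k).
Proof.
have /eqP := gs_residual (ltnSn k); rewrite subr_eq0 => /eqP ->.
rewrite (big_nth 0) big_mkord; apply: finite_span_sum => i.
by apply: finite_spanZ; rewrite gs_basisE//; exact: finite_span_base.
Qed.

(** Orthonormal initial vectors are their own residuals and have norm one, so the process returns
    them; this is what makes it an extension procedure. *)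
Lemma gs_start m : (forall i j, (i < m)%N -> (j < m)%N -> dot (x i) (x j) = (i == j)%:R) ->
  forall i, (i < m)%N -> gs_basis i = x i.
Proof.
move=> ox; have gsE n : (n <= m)%N -> gs n = mkseq x n.
  elim: n => [//|n IHn] nm; have {}IHn := IHn (ltnW nm).
  have rE k : (k < m)%N -> residual (gs n) (x k) = if (k < n)%N then 0 else x k.
    move=> km; rewrite IHn /residual.
    have -> : \sum_(g <- mkseq x n) dot g (x k) *: g = \sum_(i < n) ((i : nat) == k)%:R *: x i.
      rewrite /mkseq big_map -(big_mkord xpredT (fun i => (i == k)%:R *: x i)).
      rewrite /index_iota subn0; apply: eq_big_seq => i; rewrite mem_iota/= => ilt.
      by rewrite ox//; exact: leq_trans ilt (ltnW nm).
    case: ltnP => kn.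
      rewrite (bigD1 (Ordinal kn))//= eqxx scale1r big1 ?addr0 ?subrr// => j jk.
      rewrite (_ : (j : nat) == k = false) ?scale0r//.
      by apply/negP => /eqP e; move/negP: jk; apply; apply/eqP/val_inj.
    rewrite big1 ?subr0// => j _.
    by rewrite ltn_eqF ?scale0r// (leq_trans (ltn_ord j)).
  have nx : `|x n| = 1.
    by apply/eqP; rewrite -(@eqrXn2 _ 2)// expr1n -dot_norm ox// eqxx.
  rewrite -[gs n.+1]/(gs_step (gs n)).
  have [[_ /(_ n)]|[k [rk small -> _ _]]] := gs_stepP (@gs_on n).
    by rewrite rE// ltnn => x0; move: nx; rewrite x0 normr0 => /eqP; rewrite eq_sym oner_eq0.
  have kn : k = n.
    apply/eqP; rewrite eqn_leq; apply/andP; split; rewrite leqNgt; apply/negP => lt.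
      by move: (small n lt); rewrite rE// ltnn => x0; move: nx; rewrite x0 normr0 => /eqP; rewrite eq_sym oner_eq0.
    by move: rk; rewrite rE ?lt ?eqxx//; exact: ltn_trans lt nm.
  by rewrite kn rE// ltnn nx invr1 scale1r IHn /mkseq -addn1 iotaD map_cat/= add0n cats1.
move=> i im; rewrite -(@gs_basisE i.+1).
  by rewrite gsE// nth_mkseq.
by rewrite gsE// size_mkseq.
Qed.

End gram_schmidt.

Lemma orthonormal_basis_extend (R : realType) (H : completeNormedModType R)
    (dot : {dot H for (@idfun R)}) (m : nat) (e : nat -> H) :
  hilbert_norm dot -> separable H ->
  (forall i j, (i < m)%N -> (j < m)%N -> dot (e i) (e j) = (i == j)%:R) ->
  exists h, orthonormal_basis dot h /\ forall i, (i < m)%N -> h i = e i.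
Proof.
move=> dot_norm [S [cS dS]] oe.
(* Indices outside the image of the injection get the default 0: [y] only has to reach every point
   of [S]. *)
have [y Sy] : exists y : nat -> H, S `<=` range y.
  have [f finj] := countable_injP _ cS.
  exists (fun n => xget 0 [set z | S z /\ f z = n]) => z Sz; exists (f z) => //.
  case: xgetP => [w _ [Sw]|/(_ z)[]//]; apply: finj; exact/mem_set.
pose x n := if (n < m)%N then e n else y (n - m)%N.
have ox i j : (i < m)%N -> (j < m)%N -> dot (x i) (x j) = (i == j)%:R.
  by move=> im jm; rewrite /x im jm oe.
exists (gs_basis dot x); split; last first.
  by move=> i im; rewrite (gs_start dot_norm ox)// /x im.
have [D [DE oD]] := gs_basis_orthonormal dot_norm x.
exists D; split => //; apply: dense_sub dS => z /Sy[n _ <-].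
have := gs_basis_span dot_norm x (m + n).
by rewrite {2}/x ltnNge leq_addr/= addKn.
Qed.

(** * Laws generated by an operator *)

Section cspace_evaluation.
Context {R : realType} (T : R).
Local Notation C := (cspace T).
Local Notation I := (`[0, T]%classic : Type).

Lemma normE_cspace (f : C) : `|f| = supnorm f.
Proof. by []. Qed.

Definition eval_at (r : I) (f : C) : R := ceval f r.

Lemma eval_at_linear r : linear (eval_at r).
Proof. by []. Qed.

HB.instance Definition _ r := GRing.isLinear.Build R C R _ (eval_at r) (eval_at_linear r).

Lemma cevalZ a (f : C) r : ceval (a *: f) r = a * ceval f r.
Proof. by []. Qed.

Lemma ceval_sum J (l : seq J) (F : J -> C) r :
  ceval (\sum_(j <- l) F j) r = \sum_(j <- l) ceval (F j) r.
Proof. exact: (linear_sum (eval_at r)). Qed.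

Lemma continuous_eval_at r : continuous (eval_at r).
Proof.
apply: (@bounded_linear_continuous _ _ _ (eval_at r)).
apply/linear_boundedP; exists 1; split => // M M1 f /=.
rewrite (le_trans (le_supnorm f r))// -normE_cspace.
by rewrite ler_peMl// ltW.
Qed.

Lemma continuous_cspace_measurable (b : C -> R) :
  continuous b -> measurable_fun setT b.
Proof.
move=> cb; apply: (measurability _ (measurable_realfun.RGenOpens.measurableE R)).
move=> _ [_ [a [c ->]] <-]; rewrite setTI; apply: sub_sigma_algebra => /=.
by apply: open_comp => // x _; exact: cb.
Qed.

Lemma continuous_cspace_measurable_endo (b : C -> C) :
  continuous b -> measurable_fun setT b.
Proof.
move=> cb; apply: (@measurability _ _ C C _ _ [set U : set C | open U]) => //.
move=> _ [U oU <-]; rewrite setTI; apply: sub_sigma_algebra => /=.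
by apply: open_comp => // x _; exact: cb.
Qed.

Lemma eval_sigma_algebra_measurable s B :
  eval_sigma_algebra s B -> measurable (B : set C).
Proof.
apply: smallest_sub; first exact: sigma_algebra_measurable.
move=> _ [r _ [A mA <-]]; rewrite setTI.
apply: measurable_preimage mA; apply: continuous_cspace_measurable.
exact: continuous_eval_at.
Qed.

(** The sets that do not separate [f] from [g] form a sigma-algebra, and it contains the
    generators. *)
Lemma eval_sigma_algebra_ext s B (f g : C) :
  (forall r : I, \val r <= s -> ceval f r = ceval g r) ->
  eval_sigma_algebra s B -> B f -> B g.
Proof.
move=> fg sB; suff : [set B | B f <-> B g] B by case.
move: B sB; apply: smallest_sub.
  split => /=; first by [].
  - by move=> A Afg; split => -[_ nA]; split => // /Afg.
  - by move=> F Ffg; split => -[i _ Fi]; exists i => //; apply/Ffg.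
by move=> _ [r /= rs [A mA <-]]; rewrite /= fg.
Qed.

End cspace_evaluation.

Section generates.
Context {R : realType} (T : R) {H : completeNormedModType R}.
Variable dot : {dot H for (@idfun R)}.
Local Notation C := (cspace T).

(** A form of [generated_by] in which the law is a bare set function and the operator a bare map, so
    that images under continuous linear maps of the path space need no new process. *)
Definition generates (v : H -> C) (mu : set C -> \bar R) :=
  forall h : nat -> H, orthonormal_basis dot h ->
  forall d (Omega : measurableType d) (P : probability Omega R)
    (w : nat -> Omega -> R),
    (forall i, standard_normal P (w i)) -> mutually_independent P w ->
  exists S : Omega -> C,
    [/\ measurable_fun setT S,
      {ae P, forall x, series (fun i => w i x *: v (h i)) @ \oo --> S x} &
      forall B, measurable B -> P (S @^-1` B) = mu B].

Lemma generates_comp (v : H -> C) (mu : set C -> \bar R) (Psi : {linear C -> C}) :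
  continuous Psi -> generates v mu ->
  generates (Psi \o v) (fun B => mu (Psi @^-1` B)).
Proof.
move=> cP gen h bh d Omega P w wN wI.
have mP := continuous_cspace_measurable_endo cP.
have [S [mS cS lS]] := gen h bh d Omega P w wN wI.
exists (Psi \o S); split; first exact: measurableT_comp mP mS.
- apply: filterS cS => x cx.
  have -> : series (fun i => w i x *: (Psi \o v) (h i)) =
      Psi \o series (fun i => w i x *: v (h i)).
    apply/funext => n; rewrite /series /= linear_sum.
    by apply: eq_bigr => i _; rewrite linearZ.
  by apply: continuous_cvg => //; exact: cP.
- by move=> B mB; rewrite -lS//; exact: measurable_preimage mP mB.
Qed.

(* Both series are realised on one space carrying two equivalent probabilities,
   under which the first coordinate is N(0, 1) and N(0, c^2) respectively. *)
Lemma rescaled_basis_null_sets (s c : R) (v1 v2 : H -> C) (mu1 mu2 : set C -> \bar R)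
    (h g : nat -> H) : 0 < c ->
  generates v1 mu1 -> generates v2 mu2 ->
  orthonormal_basis dot h -> orthonormal_basis dot g ->
  (forall i (r : `[0, T]%classic), \val r <= s -> ceval (v1 (h i)) r =
    (if i == 0%N then c^-1 else 1) * ceval (v2 (g i)) r) ->
  equivalent_on (@eval_sigma_algebra R T s) mu1 mu2.
Proof.
move=> c0 gen1 gen2 bh bg vhg B sB.
have [d [ Omega [P1 [P2 [w []]]]]] := exists_iid_rescaled c0.
move=> [wN wI] /= [wN' wI'] P12.
set w' := (fun i x => _) in wN' wI'.
have [S1 [mS1 cS1 lS1]] := gen1 h bh _ _ P1 w wN wI.
have [S2 [mS2 cS2 lS2]] := gen2 g bg _ _ P2 w' wN' wI'.
have mB := eval_sigma_algebra_measurable sB.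
rewrite -lS1// -lS2//.
(* Convergence of the second series is known under [P2]; the common null sets carry it over to [P1],
   where the sums are compared. *)
have cS2' : {ae P1, forall x, series (fun i => w' i x *: v2 (g i)) @ \oo --> S2 x}.
  by apply: ae_null_sub cS2 => A mA A0; apply/P12.
have S12 : {ae P1, forall x, forall r : `[0, T]%classic, \val r <= s ->
    ceval (S1 x) r = ceval (S2 x) r}.
  apply: filterS2 cS1 cS2' => x cx1 cx2 r rs.
  have ev (f : nat -> C) (l : C) : f n @[n --> \oo] --> l ->
      ceval (f n) r @[n --> \oo] --> ceval l r.
    by move=> fl; exact: (cvg_comp _ _ fl (@continuous_eval_at R T r l)).
  have e1 := ev _ _ cx1; have := ev _ _ cx2.
  suff -> : (fun n => ceval (series (fun i => w' i x *: v2 (g i)) n) r) =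
      (fun n => ceval (series (fun i => w i x *: v1 (h i)) n) r).
    by move=> e2; exact: cvg_unique e1 e2.
  apply/funext => n; rewrite /series/= !ceval_sum.
  apply: eq_bigr => i _; rewrite !cevalZ vhg// /w'.
  by case: eqP => [->|_]; rewrite ?mul1r// mulrCA mulrA.
have mSB1 := measurable_preimage mS1 mB; have mSB2 := measurable_preimage mS2 mB.
rewrite -(P12 _ mSB2) (@ae_iff_measure _ _ _ P1 _ _ mSB1 mSB2)//.
apply: filterS S12 => x S12x; split; apply: eval_sigma_algebra_ext sB => r rs;
  by rewrite S12x.
Qed.

End generates.

(** * Removing one direction, and laws of functionals *)

Section one_dimension.
Context {R : realType} (T : R) {H : completeNormedModType R}.
Variable dot : {dot H for (@idfun R)}.
Hypotheses (dot_norm : hilbert_norm dot) (H_separable : separable H).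
Local Notation C := (cspace T).

Definition rotate_basis (a b : R) (h : nat -> H) (i : nat) : H :=
  match i with
  | 0%N => a *: h 0%N + b *: h 1%N
  | 1%N => (- b) *: h 0%N + a *: h 1%N
  | _ => h i
  end.

(** The two rotated vectors must be genuine: mixing a unit vector with a padding zero would spoil
    the norms. *)
Lemma orthonormal_basis_rotate (a b : R) (h : nat -> H) :
  a ^+ 2 + b ^+ 2 = 1 -> orthonormal_basis dot h ->
  h 0%N != 0 -> h 1%N != 0 -> orthonormal_basis dot (rotate_basis a b h).
Proof.
move=> ab1 bh h0 h1; have [D [DE oD _]] := bh; have [oh hD] := oD.
have D0 : D 0%N by apply: contrapT => /hD /eqP; exact/negP.
have D1 : D 1%N by apply: contrapT => /hD /eqP; exact/negP.
have lin2 (k l a1 b1 a2 b2 : R) (x y : H) :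
    k *: (a1 *: x + b1 *: y) + l *: (a2 *: x + b2 *: y) =
    (k * a1 + l * a2) *: x + (k * b1 + l * b2) *: y.
  by rewrite !scalerDr !scalerA addrACA -!scalerDl.
set g := rotate_basis a b h.
apply: (orthonormal_basis_change DE (h := h)) bh; last first.
  have gS := finite_span_base g.
  move=> [|[|i]]; last exact: (gS i.+2).
    have -> : h 0%N = a *: g 0%N + (- b) *: g 1%N.
      rewrite /g /= lin2 (_ : _ + _ * a = 0) ?scale0r ?addr0; last by ring.
      by rewrite mulrNN -!expr2 ab1 scale1r.
    by apply: finite_spanD; apply: finite_spanZ; exact: gS.
  have -> : h 1%N = b *: g 0%N + a *: g 1%N.
    rewrite /g /= lin2 (_ : _ + _ * - b = 0) ?scale0r ?add0r; last by ring.
    by rewrite addrC -!expr2 ab1 scale1r.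
  by apply: finite_spanD; apply: finite_spanZ; exact: gS.
split; last first.
  by move=> [|[|i]] Di; [case: Di|case: Di|exact: hD].
have dot2 (a1 b1 : R) (z : H) : dot (a1 *: h 0%N + b1 *: h 1%N) z =
    a1 * dot (h 0%N) z + b1 * dot (h 1%N) z by rewrite dotDl !dotZl.
have far i : (1 < i)%N -> D i -> dot (h 0%N) (h i) = 0 /\ dot (h 1%N) (h i) = 0.
  by case: i => [|[|i]]// _ Di; rewrite !oh.
have h00 : dot (h 0%N) (h 0%N) = 1 by rewrite oh.
have h11 : dot (h 1%N) (h 1%N) = 1 by rewrite oh.
have h01 : dot (h 0%N) (h 1%N) = 0 by rewrite oh.
have g0i i : D i.+2 -> dot (g 0%N) (g i.+2) = 0.
  by move=> Di; rewrite /g /= dot2; have [-> ->] := far i.+2 isT Di; ring.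
have g1i i : D i.+2 -> dot (g 1%N) (g i.+2) = 0.
  by move=> Di; rewrite /g /= dot2; have [-> ->] := far i.+2 isT Di; ring.
have dot22 (a1 b1 a2 b2 : R) : dot (a1 *: h 0%N + b1 *: h 1%N)
    (a2 *: h 0%N + b2 *: h 1%N) = a1 * a2 + b1 * b2.
  by rewrite dotDl !dotDr !dotZl !dotZr (dotC _ (h 1%N) (h 0%N)) h00 h11 h01; ring.
have g01 : dot (g 0%N) (g 1%N) = 0.
  by rewrite /g /= dot22; ring.
have g00 : dot (g 0%N) (g 0%N) = 1.
  by rewrite /g /= dot22 -ab1; ring.
have g11 : dot (g 1%N) (g 1%N) = 1.
  by rewrite /g /= dot22 -ab1; ring.
move=> [|[|i]] [|[|j]] Di Dj; rewrite ?g00 ?g01 ?g11 ?g0i ?g1i//.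
- by rewrite dotC g01.
- by rewrite dotC g0i.
- by rewrite dotC g1i.
- exact: oh.
Qed.

(** Let $e'=cf$ with $|f|=1$ and $\sigma^2=1+c^2$. On $[0,s]$ the path of $(f+ce)/\sigma$ is
    $\sigma$ times that of $f$, and the path of $(e-cf)/\sigma$ vanishes. After projection $f$ keeps
    its path and $e$ loses its own, so the two series differ by the factor $\sigma$ at index 0. *)
Lemma projected_null_sets (s : R) (v : {linear H -> C}) (v' : H -> C)
    (mu mu' : set C -> \bar R) (e e' : H) :
  generates dot v mu -> generates dot v' mu' ->
  dot e e = 1 -> dot e e' = 0 -> (forall x, v' x = v (x - dot e x *: e)) ->
  (forall r : `[0, T]%classic, \val r <= s -> ceval (v e') r = ceval (v e) r) ->
  equivalent_on (@eval_sigma_algebra R T s) mu mu'.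
Proof.
move=> gv gv' ee ee' v'E vee' B sB; apply: iff_sym; move: B sB.
(* If $e'=0$ there is no plane to rotate: [v e] vanishes on $[0,s]$, and the same basis with scale 1
   serves both laws. *)
have [e'0|e'0] := eqVneq e' 0.
  have [i j|h [bh h0]] := @orthonormal_basis_extend R H dot 1 (fun=> e) dot_norm H_separable.
    by case: i j => [|//] [|//] _ _; rewrite ee.
  apply: (rescaled_basis_null_sets ltr01 gv' gv bh bh) => i r rs.
  have hE : h 0%N = e by exact: h0.
  rewrite v'E invr1 (_ : (if _ then 1 else 1) = 1) ?mul1r; last by case: ifP.
  case: i => [|i]; last first.
    have [D [_ [oh hD] _]] := bh.
    suff -> : dot e (h i.+1) = 0 by rewrite scale0r subr0.
    have [Di|/hD ->] := pselect (D i.+1); last by rewrite dot0r.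
    rewrite -hE oh//; apply: contrapT => /hD; rewrite hE => e0.
    by move: ee; rewrite e0 dot0l => /eqP; rewrite eq_sym oner_eq0.
  rewrite hE ee scale1r subrr linear0 -vee'// e'0 linear0//.
pose c := `|e'|; have c0 : 0 < c by rewrite normr_gt0.
pose f := c^-1 *: e'.
have ff : dot f f = 1.
  by rewrite /f dotZl dotZr dot_norm -/c expr2 mulKf ?gt_eqF// mulVf ?gt_eqF.
have ef : dot e f = 0 by rewrite /f dotZr ee' mulr0.
have e'E : e' = c *: f by rewrite /f scalerA mulfV ?gt_eqF// scale1r.
clearbody f.
have [i j|h [bh hE]] := @orthonormal_basis_extend R H dot 2
    (fun i => if i is 0%N then f else e) dot_norm H_separable.
  by case: i j => [|[|//]] [|[|//]] _ _; rewrite ?ee ?ff ?ef// dotC ef.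
have h0 : h 0%N = f by exact: hE.
have h1 : h 1%N = e by exact: hE.
have nz x : dot x x = 1 -> x != 0.
  by move=> xx; apply/eqP => x0; move: xx; rewrite x0 dot0l => /eqP; rewrite eq_sym oner_eq0.
pose sg := Num.sqrt (1 + c ^+ 2).
have sg2 : sg ^+ 2 = 1 + c ^+ 2 by rewrite sqr_sqrtr// addr_ge0// sqr_ge0.
have sg0 : 0 < sg by rewrite sqrtr_gt0 ltr_pwDl// sqr_ge0.
have ab1 : sg^-1 ^+ 2 + (sg^-1 * c) ^+ 2 = 1.
  rewrite exprMn -{1}[sg^-1 ^+ 2]mulr1 -mulrDr -sg2 exprVn mulVf//.
  by rewrite expf_neq0// gt_eqF.
have bg : orthonormal_basis dot (rotate_basis sg^-1 (sg^-1 * c) h).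
  by apply: orthonormal_basis_rotate => //; rewrite ?h0 ?h1; exact: nz.
apply: (rescaled_basis_null_sets sg0 gv' gv bh bg) => i r rs.
have vef : ceval (v e) r = c * ceval (v f) r.
  by rewrite -vee'// e'E linearZ.
have vZ a x : v (a *: x) = a *: v x by rewrite linearZ.
have cevalD (x y : C) : ceval (x + y) r = ceval x r + ceval y r by [].
rewrite v'E; case: i => [|[|i]] /=.
- rewrite h0 h1 ef scale0r subr0 linearD !vZ cevalD !cevalZ vef.
  have sgi : sg^-1 ^+ 2 + sg^-1 ^+ 2 * c ^+ 2 = 1 by rewrite -exprMn.
  transitivity ((sg^-1 ^+ 2 + sg^-1 ^+ 2 * c ^+ 2) * ceval (v f) r).
    by rewrite sgi mul1r.
  by ring.
- rewrite h0 h1 ee scale1r subrr linear0 linearD !vZ cevalD !cevalZ vef mul1r.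
  by rewrite mulrA mulNr addNr.
- suff -> : dot e (h i.+2) = 0 by rewrite scale0r subr0 mul1r.
  have [D [_ [oh hD] _]] := bh.
  have [Di|/hD ->] := pselect (D i.+2); last by rewrite dot0r.
  rewrite -h1 oh//; apply: contrapT => /hD; rewrite h1 => e0.
  by move: ee; rewrite e0 dot0l => /eqP; rewrite eq_sym oner_eq0.
Qed.

(** The law is written as an image of N(0,1), which covers the degenerate case $|k|=0$. *)
Lemma generates_functional_law (v : H -> C) (mu : set C -> \bar R)
    (b : {linear C -> R}) (k : H) :
  generates dot v mu -> continuous b -> (forall x, b (v x) = dot k x) ->
  forall B, measurable B ->
    mu (b @^-1` B) = normal_prob 0 1 ((fun x : R => `|k| * x) @^-1` B).
Proof.
move=> gv cb bk B mB.
have [h [bh hk]] : exists h, orthonormal_basis dot h /\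
    forall i, dot k (h i) = if i == 0%N then `|k| else 0.
  have [k0|k0] := eqVneq k 0.
    have [//|h [bh _]] := @orthonormal_basis_extend R H dot 0 (fun=> 0) dot_norm H_separable.
    by exists h; split => // i; rewrite k0 dot0l normr0 if_same.
  have nk : `|k| != 0 by rewrite normr_eq0.
  pose e := `|k|^-1 *: k.
  have ee : dot e e = 1 by rewrite /e dotZl dotZr dot_norm expr2 mulKf// mulVf.
  have [i j|h [bh h0]] := @orthonormal_basis_extend R H dot 1 (fun=> e) dot_norm H_separable.
    by case: i j => [|//] [|//] _ _; rewrite ee.
  have hE : h 0%N = e by exact: h0.
  have kE : k = `|k| *: h 0%N by rewrite hE /e scalerA mulfV// scale1r.
  exists h; split => // -[|i]; first by rewrite kE dotZl hE ee mulr1 -hE -kE.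
  have [D [_ [oh hD] _]] := bh.
  have [Di|/hD ->] := pselect (D i.+1); last by rewrite dot0r.
  rewrite kE dotZl oh ?mulr0//; apply: contrapT => /hD; rewrite hE => e0.
  by move: ee; rewrite e0 dot0l => /eqP; rewrite eq_sym oner_eq0.
have [d [ Omega [P [w []]]]] := exists_iid_standard_normal R.
move=> wN wI; have [S [mS cS lS]] := gv h bh _ _ P w wN wI.
have mb := continuous_cspace_measurable cb.
have mbB := measurable_preimage mb mB.
have mk : measurable_fun [set: R] (fun x : R => `|k| * x) by exact: measurable_funM.
rewrite -lS// -(wN 0%N).2; last exact: measurable_preimage mk mB.
have bS : {ae P, forall x, b (S x) = `|k| * w 0%N x}.
  apply: filterS cS => x cx.
  have bcx : b (series (fun i => w i x *: v (h i)) n) @[n --> \oo] --> b (S x).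
    exact: (cvg_comp _ _ cx (cb (S x))).
  have kcx : b (series (fun i => w i x *: v (h i)) n) @[n --> \oo] --> `|k| * w 0%N x.
    (* Only the first basis vector contributes to [b], so the partial sums are constant from index 1
       on. *)
    apply/cvgrPdist_le => eps eps0; exists 1%N => // -[//|n] _ /=.
    suff -> : b (series (fun i => w i x *: v (h i)) n.+1) = `|k| * w 0%N x.
      by rewrite subrr normr0 ltW.
    rewrite /series/= big_nat_recl// linearD linear_sum/= big1 => [|i _].
      by rewrite addr0 linearZ/= bk hk/= mulrC.
    by rewrite linearZ/= bk hk/=; exact: mulr0.
  exact: cvg_unique bcx kcx.
apply: ae_iff_measure.
- exact: measurable_preimage mS mbB.
- exact: measurable_preimage (wN 0%N).1 (measurable_preimage mk mB).
- by apply: filterS bS => x /= ->.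
Qed.

End one_dimension.

(** * Conditioning *)

Section conditions.
Context {R : realType} (T : R) {H : completeNormedModType R}.
Variable dot : {dot H for (@idfun R)}.
Hypothesis dot_norm : hilbert_norm dot.
Local Notation C := (cspace T).
Variable u : {linear H -> C}.
Hypothesis u_cont : continuous u.
Variables (N : nat) (a : 'I_N -> {linear C -> R}).
Hypothesis a_cont : forall i, continuous (a i).
Variable e : 'I_N -> H.
Hypothesis e_basis : padded_orthonormal_basis dot (detached_space dot u a) e.

Lemma continuous_functional_riesz (b : {linear C -> R}) : continuous b ->
  exists k, forall x, b (u x) = dot k x.
Proof.
move=> cb; apply: (riesz dot_norm (f := b \o u)) => x.
by apply: continuous_comp; [exact: u_cont|exact: cb].
Qed.

Lemma padded_basis_dot : exists2 m, (m <= N)%N &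
  (forall i j, dot (e i) (e j) = ((i == j) && (i < m)%N)%:R) /\
  (forall i : 'I_N, (m <= i)%N -> e i = 0).
Proof.
have [m [mN oe e0 _]] := e_basis; exists m => //; split => // i j.
have [im|mi] := ltnP i m; last by rewrite e0// dot0l andbF.
have [jm|mj] := ltnP j m; first by rewrite oe// andbT.
by rewrite (e0 j)// dot0r; case: eqP => // ij; move: im; rewrite ij ltnNge mj.
Qed.

Lemma detached_basis j : detached_space dot u a (e j).
Proof.
have [m [_ _ _ ->]] := e_basis; exists (fun i => (i == j)%:R).
rewrite (bigD1 j)//= eqxx scale1r big1 ?addr0// => i /negbTE ->.
by rewrite scale0r.
Qed.

Lemma reduced_orthogonal x j : reduced_space u a x -> dot (e j) x = 0.
Proof. by move=> rx; exact: detached_basis rx. Qed.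

Lemma detached_expansion x : detached_space dot u a x ->
  x = \sum_j dot (e j) x *: e j.
Proof.
have [m [mN oe e0 ->]] := e_basis => -[c xE].
have [m' _ [ee' e0']] := padded_basis_dot.
rewrite [LHS]xE; apply: eq_bigr => j _.
rewrite {}xE dot_sumr (bigD1 j)//= big1 ?addr0; last first.
  by move=> i ij; rewrite dotZr ee' eq_sym (negbTE ij) mulr0.
rewrite dotZr ee' eqxx/=; have [_|mj] := ltnP j m'; first by rewrite mulr1.
by rewrite e0'// !scaler0.
Qed.

(** The vector representing a condition is orthogonal to $H^{(A)}$, hence lies in the detached
    space, which [e] spans. *)
Lemma condition_riesz i : exists2 g, (forall x, a i (u x) = dot g x) &
  g = \sum_j a i (u (e j)) *: e j.
Proof.
have [g gE] := continuous_functional_riesz (a_cont (i := i)).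
exists g => //; rewrite {1}(@detached_expansion g); last first.
  by move=> y ry; rewrite -gE ry.
by apply: eq_bigr => j _; rewrite gE dotC.
Qed.

Lemma condition_expansion i x :
  a i (u x) = \sum_j a i (u (e j)) * dot (e j) x.
Proof.
have [g -> gE] := condition_riesz i; rewrite {1}gE dot_suml.
by apply: eq_bigr => j _; rewrite dotZl.
Qed.

Lemma orthogonal_reduced x : (forall j, dot (e j) x = 0) -> reduced_space u a x.
Proof.
by move=> ex i; rewrite condition_expansion big1// => j _; rewrite ex mulr0.
Qed.

(* The rows of [1 - A *m pinvmx A] are relations between the functionals
   [x |-> <e_j, x>] modulo the conditions, hence are killed by the Gram matrix. *)
Lemma basis_from_conditions : exists B : 'M[R]_N,
  forall j x, \sum_i B i j * a i (u x) = dot (e j) x.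
Proof.
have [m mN [ee e0]] := padded_basis_dot.
pose A : 'M[R]_N := \matrix_(l, i) a i (u (e l)).
pose D : 'M[R]_N := \matrix_(l, j) dot (e l) (e j).
(* A relation [v *m A = 0] puts the combination of the [e l] with weights [v] into $H^{(A)}$, so
   every [e j] is orthogonal to it. *)
have kerD (v : 'rV[R]_N) : v *m A = 0 -> v *m D = 0.
  move=> vA; pose x := \sum_l v 0 l *: e l.
  have rx : reduced_space u a x.
    move=> i; rewrite /x !linear_sum/=.
    apply: (@etrans _ _ ((v *m A) 0 i)); last by rewrite vA mxE.
    by rewrite mxE; apply: eq_bigr => l _; rewrite !linearZ/= mxE.
  apply/rowP => j; apply: (@etrans _ _ (dot (e j) x)); last first.
    by rewrite (reduced_orthogonal j rx) mxE.
  by rewrite mxE /x dot_sumr; apply: eq_bigr => l _; rewrite mxE dotZr dotC.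
have [B DE] : exists B, D = A *m B.
  exists (pinvmx A *m D).
  apply/eqP; rewrite mulmxA -subr_eq0 -{1}[D]mul1mx -mulmxBl.
  apply/eqP/row_matrixP => l; rewrite row_mul row0; apply: kerD.
  by rewrite -row_mul mulmxBl mul1mx mulmxKpV// subrr row0.
exists B => j x.
transitivity (\sum_l D l j * dot (e l) x).
  under eq_bigr do rewrite condition_expansion mulr_sumr.
  rewrite exchange_big/=; apply: eq_bigr => l _.
  rewrite DE mxE mulr_suml; apply: eq_bigr => i _.
  by rewrite [A _ _]mxE mulrCA mulrA.
rewrite (bigD1 j)//= big1 ?addr0.
  rewrite mxE ee eqxx/=; have [_|mj] := ltnP j m; first by rewrite mul1r.
  by rewrite e0// dot0l mulr0.
by move=> l lj; rewrite mxE ee (negbTE lj) mul0r.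
Qed.

Definition project (k : nat) (x : H) : H :=
  x - \sum_(j < N | (j < k)%N) dot (e j) x *: e j.

Lemma dot_project k j x : dot (e j) (project k x) =
  if (j < k)%N then 0 else dot (e j) x.
Proof.
have [m mN [ee e0]] := padded_basis_dot.
rewrite /project dotBr dot_sumr.
have E i : i != j -> dot (e j) (dot (e i) x *: e i) = 0.
  by move=> ij; rewrite dotZr ee eq_sym (negbTE ij) mulr0.
case: ifPn => jk.
  rewrite (bigD1 j)//= big1 => [|i /andP[_ /E//]].
  rewrite addr0 dotZr ee eqxx/=; have [_|mj] := ltnP j m; first by rewrite mulr1 subrr.
  by rewrite e0// dot0l mul0r subrr.
rewrite big1 ?subr0// => i ik; apply: E; apply/eqP => ij.
by move: jk; rewrite -ij ik.
Qed.

Lemma project_reduced x : reduced_space u a (project N x).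
Proof. by apply: orthogonal_reduced => j; rewrite dot_project ltn_ord. Qed.

Lemma project_id k x : (forall j, dot (e j) x = 0) -> project k x = x.
Proof. by move=> ex; rewrite /project big1 ?subr0// => j _; rewrite ex scale0r. Qed.

Lemma project_dotC k x y : dot (project k x) y = dot x (project k y).
Proof.
rewrite /project dotBl dotBr dot_suml dot_sumr; congr (_ - _).
by apply: eq_bigr => j _; rewrite dotZl dotZr mulrC (dotC _ x).
Qed.

End conditions.

Section integration.
Local Open Scope ereal_scope.

(* [oo - oo = -oo] in [\bar R], so a finite integral forces both the positive
   and the negative part to be integrable. *)
Lemma fin_integral_integrable d (Omega : measurableType d) (R : realType)
    (P : {measure set Omega -> \bar R}) (f : Omega -> \bar R) :
  measurable_fun setT f -> \int[P]_x f x \is a fin_num ->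
  P.-integrable setT f.
Proof.
move=> mf; rewrite integralE fin_numB => /andP[fp fn].
apply/integrableP; split => //.
have -> : \int[P]_x `|f x| = \int[P]_x (f^\+ x + f^\- x).
  by apply: eq_integral => x _; have /(congr1 (fun g => g x)) := fune_abse f.
rewrite ge0_integralD//; last 2 first.
  exact: measurable_funepos.
  exact: measurable_funeneg.
by rewrite lte_add_pinfty// ltey_eq ?fp ?fn.
Qed.

Lemma same_law_integral d1 d2 d3 (Omega1 : measurableType d1)
    (Omega2 : measurableType d2) (S : measurableType d3) (R : realType)
    (P1 : {measure set Omega1 -> \bar R}) (P2 : {measure set Omega2 -> \bar R})
    (X1 : Omega1 -> S) (X2 : Omega2 -> S) (F : S -> \bar R) :
  measurable_fun setT X1 -> measurable_fun setT X2 -> measurable_fun setT F ->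
  (forall B, measurable B -> P1 (X1 @^-1` B) = P2 (X2 @^-1` B)) ->
  \int[P1]_x F (X1 x) = \int[P2]_x F (X2 x).
Proof.
move=> mX1 mX2 mF X12.
have ge0 (G : S -> \bar R) : measurable_fun setT G -> (forall s, 0 <= G s) ->
    \int[P1]_x G (X1 x) = \int[P2]_x G (X2 x).
  move=> mG G0.
  have := @ge0_integral_pushforward _ _ _ _ _ _ mX1 P1 _ _ measurableT mG
    (fun y _ => G0 y).
  rewrite preimage_setT => <-.
  have := @ge0_integral_pushforward _ _ _ _ _ _ mX2 P2 _ _ measurableT mG
    (fun y _ => G0 y).
  rewrite preimage_setT => <-.
  pose p1 : {measure set S -> \bar R} :=
    @measure_function_pushforward__canonical__measure_function_Measure
      _ _ _ _ _ P1 _ mX1.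
  pose p2 : {measure set S -> \bar R} :=
    @measure_function_pushforward__canonical__measure_function_Measure
      _ _ _ _ _ P2 _ mX2.
  exact: (@eq_measure_integral _ _ _ setT p2 p1 G (fun A mA _ => X12 A mA)).
rewrite [LHS]integralE [RHS]integralE.
have hp := ge0 F^\+ (measurable_funepos mF) (fun s => funepos_ge0 F s).
have hn := ge0 F^\- (measurable_funeneg mF) (fun s => funeneg_ge0 F s).
have pE T (Y : T -> S) x : (fun y => F (Y y))^\+ x = F^\+ (Y x) by rewrite !funeposE.
have nE T (Y : T -> S) x : (fun y => F (Y y))^\- x = F^\- (Y x) by rewrite !funenegE.
under [X in X - _ = _]eq_integral do rewrite pE.
under [X in _ - X = _]eq_integral do rewrite nE.
under [X in _ = X - _]eq_integral do rewrite pE.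
under [X in _ = _ - X]eq_integral do rewrite nE.
by rewrite hp hn.
Qed.

(** [X1] and [X2] have the law of [X], while [F] changes sign between them. The integral is thus its
    own opposite, and finite by integrability. *)
Lemma antisymmetric_integral0 d1 d2 d3 (Omega1 : measurableType d1)
    (Omega2 : measurableType d2) (S : measurableType d3) (R : realType)
    (P1 : {measure set Omega1 -> \bar R}) (P2 : {measure set Omega2 -> \bar R})
    (X : Omega1 -> S) (X1 X2 : Omega2 -> S) (F : S -> R) :
  measurable_fun setT X -> measurable_fun setT X1 -> measurable_fun setT X2 ->
  measurable_fun setT F -> P1.-integrable setT (fun x => (F (X x))%:E) ->
  (forall B, measurable B -> P2 (X1 @^-1` B) = P1 (X @^-1` B)) ->
  (forall B, measurable B -> P2 (X2 @^-1` B) = P1 (X @^-1` B)) ->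
  {ae P2, forall x, F (X2 x) = (- F (X1 x))%R} ->
  \int[P1]_x (F (X x))%:E = 0.
Proof.
move=> mX mX1 mX2 mF iF l1 l2 ae.
have mFE : measurable_fun setT (EFin \o F) by exact/measurable_EFinP.
have E1 := same_law_integral mX1 mX mFE l1.
have E2 := same_law_integral mX2 mX mFE l2.
have mF1 : measurable_fun setT (EFin \o F \o X1) by exact: measurableT_comp mFE mX1.
have mF2 : measurable_fun setT (EFin \o F \o X2) by exact: measurableT_comp mFE mX2.
have fin : \int[P1]_x (F (X x))%:E \is a fin_num by exact: integrable_fin_num.
have i1 : P2.-integrable setT (EFin \o F \o X1).
  by apply: fin_integral_integrable => //=; rewrite E1.
have E12 : \int[P2]_x (F (X2 x))%:E = - \int[P2]_x (F (X1 x))%:E.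
  rewrite -integralN/=; last exact: integrable_add_def.
  apply: ae_eq_integral => //; first by exact: (measurableT_comp (@oppe_measurable _ setT) mF1).
  by apply: filterS ae => x -> _.
move: E12; rewrite E1 E2 => /eqP; move: fin.
by case: (\int[P1]_x _) => // r _; rewrite eqe => /eqP rr; congr EFin; lra.
Qed.

Lemma sigma_algebra_setI T (G : set (set T)) (A B : set T) :
  <<s G >> A -> <<s G >> B -> <<s G >> (A `&` B).
Proof.
move=> GA GB; rewrite -[A `&` B]setCK setCI.
have GC D : <<s G >> D -> <<s G >> (~` D).
  by move=> GD; rewrite -setTD; exact: sigma_algebraCD.
apply: (GC _); rewrite -bigcup2E; apply: sigma_algebra_bigcup => -[|[|i]] /=.
- exact: GC.
- exact: GC.
- exact: sigma_algebra0.
Qed.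

(** For each rational $q$ the event $W<q<Z$ lies in the sigma-algebra, so [Z] and [W] have the same
    integral over it and it is null. These events cover $W<Z$. *)
Lemma cond_expectation_unique_le d (Omega : measurableType d) (R : realType)
    (P : probability Omega R) (G : set (set Omega)) (Z W : Omega -> R) :
  <<s G >> `<=` measurable ->
  (forall B : set R, measurable B -> <<s G >> (Z @^-1` B)) ->
  (forall B : set R, measurable B -> <<s G >> (W @^-1` B)) ->
  P.-integrable setT (EFin \o Z) -> P.-integrable setT (EFin \o W) ->
  (forall E, <<s G >> E -> \int[P]_(x in E) (Z x)%:E = \int[P]_(x in E) (W x)%:E) ->
  {ae P, forall x, (Z x <= W x)%R}.
Proof.
move=> Gm GZ GW iZ iW ZW.
pose E (q : R) := W @^-1` `]-oo, q[ `&` Z @^-1` `]q, +oo[.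
have GE q : <<s G >> (E q) by apply: sigma_algebra_setI; [exact: GW|exact: GZ].
have E0 q : P.-negligible (E q).
  have mE : measurable (E q) by exact/Gm.
  have iZE : P.-integrable (E q) (EFin \o Z) by exact: integrableS iZ.
  have iWE : P.-integrable (E q) (EFin \o W) by exact: integrableS iW.
  have : \int[P]_(x in E q) `|(Z x)%:E - (W x)%:E| = 0.
    transitivity (\int[P]_(x in E q) ((Z x)%:E - (W x)%:E)).
      apply: eq_integral => x; rewrite inE /E/= !in_itv/= andbT => -[Wq qZ].
      by congr EFin; rewrite ger0_norm// subr_ge0 ltW// (lt_trans Wq).
    rewrite (integralB mE iZE iWE) ZW// subee//; exact: integrable_fin_num.
  move=> /(ae_eq_integral_abs P mE (measurable_int _ (integrableB mE iZE iWE))).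
  case=> N [mN N0 EN]; exists N; split => // x Ex; apply: EN => /= /(_ Ex) /eqP.
  rewrite -EFinB eqe subr_eq0 => /eqP xE; move: Ex.
  by rewrite /E/= !in_itv/= xE andbT => -[/lt_trans h /h]; rewrite ltxx.
pose q n : R := ratr (odflt 0%Q (unpickle n)).
have [N [mN N0 EN]] := negligible_bigcup (fun n => E0 (q n)).
exists N; split => // x /= /negP; rewrite -ltNge => WZ; apply: EN.
have [r] := rat_in_itvoo WZ; rewrite in_itv/= => /andP[Wr rZ].
exists (pickle r) => //; rewrite /E /q /= pickleK/= !in_itv/= andbT.
by split.
Qed.

End integration.

Lemma combination_g_sigma_preimage (R : realType) (T : Type) (n : nat)
    (f : 'I_n -> T -> R) (c : 'I_n -> R) (B : set R) : measurable B ->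
  g_sigma_preimage f ((fun x => \sum_i c i * f i x) @^-1` B).
Proof.
move=> mB; pose t x := [tuple f i x | i < n].
have tE (D : set (n.-tuple R)) : measurable D -> g_sigma_preimage f (t @^-1` D).
  move: D; apply: smallest_sub.
    split => /=.
    - by rewrite preimage_set0; exact: sigma_algebra0.
    - by move=> A fA; rewrite setTD preimage_setC -setTD; exact: sigma_algebraCD.
    - by move=> F fF; rewrite preimage_bigcup; exact: sigma_algebra_bigcup.
  move=> A; rewrite -bigcup_seq => -[i _ [D mD <-]].
  apply: sub_sigma_algebra; rewrite -bigcup_seq; exists i => /=.
    by rewrite mem_index_enum.
  by exists D => //; rewrite !setTI; apply/seteqP; split => x /=; rewrite /t tnth_mktuple.
pose g (y : n.-tuple R) := \sum_i c i * tnth y i.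
have mg : measurable_fun setT g.
  apply: measurable_sum => i; apply: measurable_funM => //; exact: measurable_tnth.
rewrite (_ : (fun x => _) = g \o t); last first.
  by apply/funext => x; rewrite /g/=; apply: eq_bigr => i _; rewrite tnth_mktuple.
exact: (tE _ (measurable_preimage mg mB)).
Qed.

Lemma cvg_finite_sum (R : realType) (V : normedModType R) (T I : Type)
    (F : set_system T) (FF : Filter F) (r : seq I) (Q : pred I)
    (f : I -> T -> V) (l : I -> V) :
  (forall i, Q i -> f i x @[x --> F] --> l i) ->
  \sum_(i <- r | Q i) f i x @[x --> F] --> \sum_(i <- r | Q i) l i.
Proof. by move=> fl; apply: cvg_big => //; exact: add_continuous. Qed.

Section conditioning.
Context {R : realType} (T : R) {H : completeNormedModType R}.
Variable dot : {dot H for (@idfun R)}.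
Hypotheses (dot_norm : hilbert_norm dot) (H_separable : separable H).
Local Notation C := (cspace T).
Variable u : {linear H -> C}.
Hypothesis u_cont : continuous u.
Variables (N : nat) (a : 'I_N -> {linear C -> R}).
Hypothesis a_cont : forall i, continuous (a i).
Variable e : 'I_N -> H.
Hypothesis e_basis : padded_orthonormal_basis dot (detached_space dot u a) e.
Variable B : 'M[R]_N.
Hypothesis BE : forall j x, \sum_i B i j * a i (u x) = dot (e j) x.

Definition coordinate (j : 'I_N) (f : C) : R := \sum_i B i j * a i f.

(** It acts on every path, through the conditions, because the paths of [X] need not lie in the
    range of [u]; on that range it is [u] after [project]. *)
Definition conditioning (k : nat) (f : C) : C :=
  f - \sum_(j < N | (j < k)%N) coordinate j f *: u (e j).

Lemma coordinate_linear j : linear (coordinate j).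
Proof.
move=> c x y; rewrite /coordinate scaler_sumr -big_split; apply: eq_bigr => i _.
by rewrite linearP /= mulrDr; congr (_ + _); exact: mulrCA.
Qed.

HB.instance Definition _ j :=
  GRing.isLinear.Build R C R _ (coordinate j) (coordinate_linear j).

Lemma coordinate_continuous j : continuous (coordinate j).
Proof.
move=> f; apply: (cvg_finite_sum (nbhs_filter f)) => i _.
by apply: (@cvgM _ _ (nbhs f) (nbhs_filter f)); [exact: cvg_cst|exact: a_cont].
Qed.

Lemma conditioning_linear k : linear (conditioning k).
Proof.
move=> c x y; rewrite /conditioning scalerBr scaler_sumr addrACA -opprD -big_split.
congr (_ - _); apply: eq_bigr => j _.
by rewrite linearP scalerDl scalerA.
Qed.

HB.instance Definition _ k :=
  GRing.isLinear.Build R C C _ (conditioning k) (conditioning_linear k).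

Lemma conditioning_continuous k : continuous (conditioning k).
Proof.
move=> f; apply: (@cvgB R C C (nbhs f) (nbhs_filter f) id); first exact: cvg_id.
apply: (cvg_finite_sum (nbhs_filter f)) => j _.
apply: (@cvgZr_tmp _ _ _ (nbhs f) (nbhs_filter f)).
exact: coordinate_continuous.
Qed.

Lemma conditioning_generator k x :
  conditioning k (u x) = u (project dot e k x).
Proof.
rewrite /conditioning /project [RHS]linearB [u (\sum_(_ | _) _)]linear_sum.
apply: (f_equal (fun z => u x - z)).
by apply: eq_bigr => j _; rewrite linearZ /coordinate BE.
Qed.

End conditioning.

Lemma series_functional_ae (R : realType) (T : R) (H : completeNormedModType R)
    (d : measure_display) (Omega : measurableType d) (P : probability Omega R)
    (u : H -> cspace T) (w : nat -> Omega -> R) (h1 h2 : nat -> H)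
    (S1 S2 : Omega -> cspace T) (b : {linear cspace T -> R}) (c : R) :
  continuous b -> (forall i, b (u (h2 i)) = c * b (u (h1 i))) ->
  {ae P, forall x, series (fun i => w i x *: u (h1 i)) @ \oo --> S1 x} ->
  {ae P, forall x, series (fun i => w i x *: u (h2 i)) @ \oo --> S2 x} ->
  {ae P, forall x, b (S2 x) = c * b (S1 x)}.
Proof.
move=> cb bc; apply: filterS2 => x c1 c2.
have e1 : c * b (series (fun i => w i x *: u (h1 i)) n) @[n --> \oo] --> c * b (S1 x).
  by apply: cvgMr; exact: (cvg_comp _ _ c1 (cb (S1 x))).
have : b (series (fun i => w i x *: u (h2 i)) n) @[n --> \oo] --> b (S2 x).
  exact: (cvg_comp _ _ c2 (cb (S2 x))).
suff -> : (fun n => b (series (fun i => w i x *: u (h2 i)) n)) =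
    (fun n => c * b (series (fun i => w i x *: u (h1 i)) n)).
  by move=> e2; exact: cvg_unique e2 e1.
apply/funext => n; rewrite /series/= !linear_sum mulr_sumr.
apply: eq_bigr => i _; rewrite !linearZ/= bc; exact: mulrCA.
Qed.

(** The last clause says that membership in [A] depends on the values of the conditions alone; it
    makes such events invariant under the sign flip. *)
Lemma g_sigma_preimage_compE (R : realType) d (Omega : measurableType d)
    d' (S : measurableType d') (X : Omega -> S) (n : nat) (a : 'I_n -> S -> R)
    (E : set Omega) :
  (forall i, measurable_fun setT (a i)) ->
  g_sigma_preimage (fun i w => a i (X w)) E ->
  exists A, [/\ measurable A, E = X @^-1` A &
    forall f g, (forall i, a i f = a i g) -> A f -> A g].
Proof.
move=> ma; move: E; apply: smallest_sub; first split.
- by exists set0; split; rewrite ?preimage_set0.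
- move=> E [A [mA -> Aa]]; exists (~` A); split.
  + exact: measurableC.
  + by rewrite setTD preimage_setC.
  + by move=> f g fg nAf Ag; apply: nAf; apply: Aa Ag.
- move=> F /choice[A AP]; exists (\bigcup_i A i); split.
  + by apply: bigcupT_measurable => i; case: (AP i).
  + by rewrite preimage_bigcup; apply: eq_bigcupr => i _; case: (AP i).
  + by move=> f g fg [i _ Af]; exists i => //; case: (AP i) => _ _ /(_ _ _ fg); apply.
move=> E; rewrite -bigcup_seq => -[i _ [D mD <-]]; exists (a i @^-1` D); split.
- exact: measurable_preimage (ma i) mD.
- by rewrite setTI.
- by move=> f g /= ->.
Qed.

(** * Conditional expectation by symmetry *)

Section conditional_law.
Context {R : realType} (T : R) {H : completeNormedModType R}.
Variable dot : {dot H for (@idfun R)}.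
Hypotheses (dot_norm : hilbert_norm dot) (H_separable : separable H).
Local Notation C := (cspace T).
Variable u : {linear H -> C}.
Hypothesis u_cont : continuous u.
Variables (N : nat) (a : 'I_N -> {linear C -> R}).
Hypothesis a_cont : forall i, continuous (a i).
Variable e : 'I_N -> H.
Hypothesis e_basis : padded_orthonormal_basis dot (detached_space dot u a) e.
Variable B : 'M[R]_N.
Hypothesis BE : forall j x, \sum_i B i j * a i (u x) = dot (e j) x.
Context d (Omega : measurableType d) (P : probability Omega R).
Variable X : Omega -> C.
Hypothesis mX : measurable_fun setT X.
Hypothesis gX : generates dot u (fun A => P (X @^-1` A)).

Local Notation psi := (conditioning u a e B N).

Lemma adapted_basis : exists h m,
  [/\ orthonormal_basis dot h, forall j : 'I_N, (j < m)%N -> h j = e j,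
      forall l, (l < m)%N -> project dot e N (h l) = 0 &
      forall l, (m <= l)%N -> forall j, dot (e j) (h l) = 0].
Proof.
have [m mN [ee e0]] := padded_basis_dot e_basis.
pose e' (i : nat) := if insub i is Some j then e j else 0.
have e'E (j : 'I_N) : e' j = e j by rewrite /e' valK.
have [i j im jm|h [bh hE]] := @orthonormal_basis_extend R H dot m e' dot_norm H_separable.
  have iN := leq_trans im mN; have jN := leq_trans jm mN.
  have := ee (Ordinal iN) (Ordinal jN); rewrite -!e'E /= => ->.
  by rewrite im andbT.
have hj (j : 'I_N) : (j < m)%N -> h j = e j by move=> jm; rewrite hE// e'E.
exists h, m; split => //.
- move=> l lm; have lN := leq_trans lm mN.
  rewrite (hj (Ordinal lN) lm) /project (bigD1 (Ordinal lN))//= big1 => [|i /andP[_ il]].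
    by rewrite ee eqxx lm scale1r addr0 subrr.
  by rewrite ee (negbTE il) scale0r.
- move=> l ml j; have [jm|mj] := ltnP j m; last by rewrite e0// dot0l.
  rewrite -hj//; have [D [_ [oh hD] _]] := bh.
  have [Dl|/hD ->] := pselect (D l); last by rewrite dot0r.
  have [Dj|/hD ->] := pselect (D j); last by rewrite dot0l.
  by rewrite oh// ltn_eqF// (leq_trans jm).
Qed.

Lemma orthonormal_basis_sign (h : nat -> H) (m : nat) : orthonormal_basis dot h ->
  orthonormal_basis dot (fun l => if (l < m)%N then h l else - h l).
Proof.
move=> bh; have [D [DE [oh hD] _]] := bh.
apply: (orthonormal_basis_change DE _ _ bh).
  split=> [i j Di Dj|i /hD ->]; last by rewrite oppr0 if_same.
  case: ltnP => im; case: ltnP => jm; rewrite ?dotNl ?dotNr ?opprK oh//.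
    by rewrite ltn_eqF ?oppr0// (leq_trans im).
  by rewrite gtn_eqF ?oppr0// (leq_trans jm).
move=> l; set g := (fun l => _).
have -> : h l = (if (l < m)%N then 1 else -1) *: g l.
  by rewrite /g; case: ifP => _; rewrite ?scale1r// scaleN1r opprK.
by apply: finite_spanZ; exact: finite_span_base.
Qed.

Lemma conditioned_symmetric_integral (b : {linear C -> R}) (E : set Omega) :
  continuous b -> P.-integrable setT (fun w => (b (psi (X w)))%:E) ->
  g_sigma_preimage (fun i w => a i (X w)) E ->
  (\int[P]_(w in E) (b (psi (X w)))%:E = 0)%E.
Proof.
move=> cb ib GE.
have ma i : measurable_fun setT (a i) by exact: continuous_cspace_measurable.
have [A [mA EA Aa]] := g_sigma_preimage_compE ma GE.
pose bpsi : {linear C -> R} := b \o psi.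
have cpsi : continuous psi by exact: conditioning_continuous.
have cbpsi : continuous bpsi.
  by move=> f; apply: continuous_comp; [exact: cpsi|exact: cb].
pose F (f : C) : R := bpsi f * \1_A f.
have mF : measurable_fun setT F.
  by apply: measurable_funM; [exact: continuous_cspace_measurable|exact: measurable_indic].
have FE w : ((fun w => (b (psi (X w)))%:E) \_ E) w = (F (X w))%:E.
  rewrite patchE EA /F indicE (_ : (w \in X @^-1` A) = (X w \in A)); last first.
    by apply/idP/idP; rewrite !inE.
  case: ifP => _.
    by rewrite mulr1.
  by rewrite mulr0.
have iF : P.-integrable setT (fun w => (F (X w))%:E).
  have mE : measurable E by rewrite EA; exact: measurable_preimage mX mA.
  apply: (eq_integrable measurableT _ _ (fun w _ => FE w)).
  by rewrite -integrable_mkcond//; exact: integrableS ib.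
rewrite integral_mkcond (eq_integral _ _ (fun w _ => FE w)).
have [h [m [bh hj hlt hge]]] := adapted_basis.
have bh' := orthonormal_basis_sign m bh.
have [d' [ Omega' [P' [w []]]]] := exists_iid_standard_normal R.
move=> wN wI.
(* The same normals drive both bases, which realises the flip pathwise: the conditions agree at [S1]
   and [S2], and [bpsi] changes sign. *)
have [S1 [mS1 cS1 lS1]] := gX bh wN wI.
have [S2 [mS2 cS2 lS2]] := gX bh' wN wI.
apply: (antisymmetric_integral0 mX mS1 mS2 mF iF lS1 lS2).
have aS i : {ae P', forall x, a i (S2 x) = 1 * a i (S1 x)}.
  apply: (series_functional_ae (@a_cont i) _ cS1 cS2) => l.
  rewrite mul1r; case: ltnP => // ml; rewrite !linearN/= (condition_expansion dot_norm u_cont a_cont e_basis).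
  by rewrite big1 ?oppr0// => j _; rewrite hge// mulr0.
have bS : {ae P', forall x, bpsi (S2 x) = -1 * bpsi (S1 x)}.
  apply: (series_functional_ae cbpsi _ cS1 cS2) => l.
  case: ltnP => lm; last by rewrite !linearN/= mulN1r.
  by rewrite /bpsi /= (conditioning_generator BE) hlt// !linear0 mulr0.
have aS' : {ae P', forall x, forall i, a i (S2 x) = a i (S1 x)}.
  by apply: filter_forall => i; apply: filterS (aS i) => x ->; rewrite mul1r.
apply: filterS2 aS' bS => x aE bE; rewrite /F bE.
suff -> : \1_A (S2 x) = \1_A (S1 x) :> R by rewrite mulN1r mulNr.
rewrite !indicE; suff -> : (S2 x \in A) = (S1 x \in A) by [].
apply/idP/idP; rewrite !inE; apply: Aa => i;
  by rewrite aE.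
Qed.

Lemma cond_expectation_conditioning (b : {linear C -> R}) (Z : Omega -> R) :
  continuous b ->
  (forall c : {linear C -> R}, continuous c -> P.-integrable setT (fun w => (c (X w))%:E)) ->
  is_cond_expectation P (g_sigma_preimage (fun i w => a i (X w))) (fun w => b (X w)) Z ->
  {ae P, forall w, b (X w) - Z w = b (psi (X w))}.
Proof.
move=> cb iX [GZ iZ ZE].
(* [W] is [b] of the part that [psi] removes, rearranged as a combination of the conditions, which
   shows its measurability. *)
pose W (w : Omega) : R := \sum_i (\sum_j B i j * b (u (e j))) * a i (X w).
have cpsi : continuous psi by exact: conditioning_continuous.
pose bpsi : {linear C -> R} := b \o psi.
have cbpsi : continuous bpsi.
  by move=> f; apply: continuous_comp; [exact: cpsi|exact: cb].
have WE w : W w = b (X w) - b (psi (X w)).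
  rewrite /conditioning linearB opprB addrC subrK linear_sum.
  rewrite (eq_bigl xpredT) => [|j]; last by rewrite ltn_ord.
  under [RHS]eq_bigr do rewrite linearZ /=.
  transitivity (\sum_i \sum_j B i j * b (u (e j)) * a i (X w)).
    by apply: eq_bigr => i _; rewrite mulr_suml.
  rewrite exchange_big /=; apply: eq_bigr => j _.
  rewrite -[RHS]/((\sum_i B i j * a i (X w)) * b (u (e j))) mulr_suml; apply: eq_bigr => i _.
  by rewrite -mulrA [X in _ * X]mulrC mulrA.
have ma i : measurable_fun setT (a i) by exact: continuous_cspace_measurable.
have Gm : g_sigma_preimage (fun i w => a i (X w)) `<=` measurable.
  move=> E GE; have [A [mA -> _]] := g_sigma_preimage_compE ma GE.
  exact: measurable_preimage mX mA.
have GW (D : set R) : measurable D -> g_sigma_preimage (fun i w => a i (X w)) (W @^-1` D).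
  exact: combination_g_sigma_preimage.
have ib := iX b cb; have ibpsi := iX bpsi cbpsi.
have iW : P.-integrable setT (EFin \o W).
  have -> : EFin \o W = (fun w => (b (X w))%:E - (bpsi (X w))%:E)%E.
    by apply/funext => w /=; rewrite WE EFinB.
  exact: integrableB.
have ZW E : g_sigma_preimage (fun i w => a i (X w)) E ->
    (\int[P]_(x in E) (Z x)%:E = \int[P]_(x in E) (W x)%:E)%E.
  move=> GE; have mE := Gm _ GE.
  rewrite ZE// -[LHS]sube0 -(conditioned_symmetric_integral cb ibpsi GE).
  rewrite -integralB//.
  - by apply: eq_integral => w _; rewrite WE EFinB.
  - exact: integrableS ib.
  - exact: integrableS ibpsi.
have l1 := cond_expectation_unique_le Gm GZ GW iZ iW ZW.
have l2 := cond_expectation_unique_le Gm GW GZ iW iZ (fun E GE => esym (ZW E GE)).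
apply: filterS2 l1 l2 => w h1 h2.
have -> : Z w = W w by apply/eqP; rewrite eq_le h1 h2.
by rewrite WE opprB addrC subrK.
Qed.

End conditional_law.

(** Over the whole space, the defining identity of a conditional expectation equates the integral of
    [b (X w)] with that of an integrable version; a finite integral then gives integrability. *)
Lemma conditioned_integrable (R : realType) (T : R) d (Omega : measurableType d)
    (P : probability Omega R) (X : {mfun Omega >-> cspace T}) (N : nat)
    (a : 'I_N -> {linear cspace T -> R}) d' (Omega' : measurableType d')
    (Q : probability Omega' R) (Y : {mfun Omega' >-> cspace T})
    (b : {linear cspace T -> R}) :
  conditioned_process P X a Q Y -> continuous b ->
  P.-integrable setT (fun w => (b (X w))%:E).
Proof.
move=> [_ cY] cb; have [//|Z [/(_ ord0)[_ iZ ZE] _]] := cY 1%N (fun=> b).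
apply: fin_integral_integrable.
  apply/measurable_EFinP; apply: measurableT_comp (measurable_funPT X).
  exact: continuous_cspace_measurable.
rewrite -ZE; first exact: integrable_fin_num.
by rewrite -[setT]setC0 -setTD; apply: sigma_algebraCD; exact: sigma_algebra0.
Qed.

(** Finite-dimensional distributions decide: evaluations are admissible functionals in
    [conditioned_process], and the finite cylinders form a pi-system whose sigma-algebra contains
    $\mathcal F_s$. *)
Lemma conditioned_law (R : realType) (T : R) (T_ge0 : 0 <= T)
    (H : completeNormedModType R) (dot : {dot H for (@idfun R)})
    (dot_norm : hilbert_norm dot) (H_separable : separable H)
    (u : {linear H -> cspace T}) (u_cont : continuous u)
    d (Omega : measurableType d) (P : probability Omega R)
    (X : {mfun Omega >-> cspace T})
    (gX : generates dot u (fun A => P (X @^-1` A)))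
    (N : nat) (a : 'I_N -> {linear cspace T -> R})
    (a_cont : forall i, continuous (a i))
    d' (Omega' : measurableType d') (Q : probability Omega' R)
    (Y : {mfun Omega' >-> cspace T}) (cY : conditioned_process P X a Q Y)
    (e : 'I_N -> H)
    (e_basis : padded_orthonormal_basis dot (detached_space dot u a) e)
    (B : 'M[R]_N) (BE : forall j x, \sum_i B i j * a i (u x) = dot (e j) x) s A :
  eval_sigma_algebra s A ->
  Q (Y @^-1` A) = P (X @^-1` (conditioning u a e B N @^-1` A)).
Proof.
move=> sA; pose psi := conditioning u a e B N.
pose I := (`[0, T]%classic : Type).
have mX := measurable_funPT X; have mY := measurable_funPT Y.
have cpsi : continuous psi by exact: conditioning_continuous.
have mpsi := continuous_cspace_measurable_endo cpsi.
have mev (r : I) : measurable_fun setT (fun f : cspace T => ceval f r).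
  by apply: continuous_cspace_measurable; exact: continuous_eval_at.
pose cyl n (r : nat -> I) (D : nat -> set R) : set (cspace T) :=
  [set f | forall k, (k < n)%N -> D k (ceval f (r k))].
pose G : set (set (cspace T)) := [set A | exists n r D,
  (forall k, measurable (D k)) /\ A = cyl n r D].
have Gm : G `<=` measurable.
  move=> _ [n [r [D [mD ->]]]].
  rewrite (_ : cyl n r D = \bigcap_(k < n) ((fun f => ceval f (r k)) @^-1` D k))//.
  by apply: bigcap_measurableType => k _; exact: measurable_preimage (mev _) (mD k).
have GI : setI_closed G.
  move=> _ _ [n [r [D [mD ->]]]] [m [r' [D' [mD' ->]]]].
  exists (n + m)%N, (fun k => if (k < n)%N then r k else r' (k - n)%N).
  exists (fun k => if (k < n)%N then D k else D' (k - n)%N); split.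
    by move=> k; case: ifP.
  apply/seteqP; split => f /=.
    move=> [fD fD'] k knm; case: ltnP => kn; first exact: fD.
    by apply: fD'; rewrite ltn_subLR.
  move=> fDD'; split => k km.
    by have := fDD' k (ltn_addr _ km); rewrite km.
  by have := fDD' (n + k)%N; rewrite ltn_add2l (ltnNge (n + k)%N) leq_addr/= addKn; apply.
(* The unconstrained cylinder still carries a sequence of times; $T\ge0$ provides one. *)
have r0 : I.
  by exists 0; rewrite inE/= in_itv/= lexx.
have GT : G setT.
  by exists 0%N, (fun=> r0), (fun=> setT); split => //; apply/seteqP; split.
have sG : eval_sigma_algebra s `<=` <<s G >>.
  apply: smallest_sub; first exact: smallest_sigma_algebra.
  move=> _ [r _ [D mD <-]]; apply: sub_sigma_algebra.
  exists 1%N, (fun=> r), (fun=> D); split => //.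
  apply/seteqP; split => f /=; first by move=> [_ Df] [|].
  by move=> /(_ 0%N isT).
apply: (@pi_system_unique _ _ _ _ _ _ _ Q P Y (psi \o X) G) => //; last exact: sG.
- exact: measurableT_comp mpsi mX.
- by apply: le_lt_trans (probability_le1 Q measurableT) _; exact: ltry.
move=> _ [n [r [D [mD ->]]]].
have cint := conditioned_integrable cY.
have [_ /(_ n (fun k => eval_at (r k) : {linear cspace T -> R}))] := cY.
case=> [k|Z [Zc lZ]]; first exact: continuous_eval_at.
pose DD : set (n.-tuple R) := [set t | forall k : 'I_n, D k (tnth t k)].
have mDD : measurable DD.
  rewrite (_ : DD = \bigcap_(k in [set: 'I_n]) (@tnth n R ^~ k @^-1` D k)).
    apply: fin_bigcap_measurable => // k _.
    exact: measurable_preimage (measurable_tnth k) (mD k).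
  by apply/seteqP; split => t /= Dt k; [move=> _|]; exact: Dt.
have := lZ _ mDD.
have -> : (fun w => [tuple (eval_at (r k) : {linear cspace T -> R}) (Y w) | k < n])
    @^-1` DD = Y @^-1` cyl n r D.
  apply/seteqP; split => w /=.
    by move=> DY k kn; have := DY (Ordinal kn); rewrite tnth_mktuple.
  by move=> DY k; rewrite tnth_mktuple; exact: DY.
move=> QE; apply: etrans QE _; apply: ae_iff_measure.
- apply: measurable_preimage mDD; apply/measurable_fun_tnthP => k.
  have mbk : measurable_fun setT (fun w => ceval (X w) (r k) - Z k w).
    apply: measurable_funB; first exact: measurableT_comp (mev _) mX.
    by apply/measurable_EFinP; case: (Zc k) => _ iZ _; exact: measurable_int iZ.
  by apply: eq_measurable_fun mbk => w _ /=; rewrite tnth_mktuple.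
- have mc : measurable (cyl n r D) by apply: Gm; exists n, r, D.
  exact: measurable_preimage mX (measurable_preimage mpsi mc).
have aZ : {ae P, forall w, forall k : 'I_n,
    ceval (X w) (r k) - Z k w = ceval (psi (X w)) (r k)}.
  apply: filter_forall => k.
  apply: (cond_expectation_conditioning dot_norm H_separable u_cont a_cont
    e_basis BE mX gX (b := eval_at (r k)) (@continuous_eval_at R T (r k)) cint (Zc k)).
apply: filterS aZ => w wE; split => /=.
  move=> Dw k kn; have := Dw (Ordinal kn); rewrite tnth_mktuple.
  by have /= -> := wE (Ordinal kn).
by move=> Dw k; rewrite tnth_mktuple; have /= -> := wE k; exact: Dw.
Qed.

(** * Singularity and matching *)

Section singularity.
Variable R : realType.
Local Notation N01 := (normal_prob 0 1 : probability (measurableTypeR R) R).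

Lemma vanishing_intersection d (T : measurableType d) (P : probability T R)
    (F : nat -> set T) (delta : R) : 0 < delta ->
  (forall n, measurable (F n)) -> (forall n m, (n <= m)%N -> F m `<=` F n) ->
  P (\bigcap_n F n) = 0%E -> exists n, (P (F n) <= delta%:E)%E.
Proof.
move=> delta0 mF Fdec F0; apply: contrapT => /forallNP nF.
have cv : (P \o F) n @[n --> \oo] --> P (\bigcap_n F n).
  apply: nonincreasing_cvg_mu => //.
  - by apply: le_lt_trans (probability_le1 P (mF 0%N)) _; exact: ltry.
  - by apply: bigcap_measurableType.
  - by move=> n m nm; apply/subsetPset; exact: Fdec.
have : (delta%:E <= limn (P \o F))%E.
  apply: lime_ge; first exact: cvgP cv.
  by apply: nearW => n /=; have /negP := nF n; rewrite -ltNge => /ltW.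
by rewrite (cvg_lim _ cv)// F0 lee_fin leNgt delta0.
Qed.

Lemma normal_small_ball (delta : R) : 0 < delta ->
  exists2 eps : R, 0 < eps & (N01 [set x | (`|x| <= eps)%R] <= delta%:E)%E.
Proof.
move=> delta0; pose F n := [set x : R | `|x| <= n.+1%:R^-1].
have FE n : F n = `[- n.+1%:R^-1, n.+1%:R^-1]%classic.
  by apply/seteqP; split => x; rewrite /F /= in_itv/= ler_norml.
have [|||n nP] := @vanishing_intersection _ _ N01 F delta delta0.
- by move=> n; rewrite FE; exact: measurable_itv.
- move=> n m nm x /= /le_trans; apply.
  by rewrite lef_pV2 ?posrE ?ltr0n// ler_nat.
- have -> : \bigcap_n F n = [set 0].
    apply/seteqP; split => x /=; last by move=> -> n _ /=; rewrite /F /= normr0 invr_ge0.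
    move=> Fx; apply/eqP; rewrite -normr_eq0 eq_le normr_ge0 andbT leNgt.
    apply/negP => /ltr_add_invr[n]; rewrite add0r => nx.
    by have := Fx n I; rewrite /F/= leNgt nx.
  apply: (@normal_prob_dominates R 0 1 [set 0]) => // D mD D0.
  exact: (@subset_measure0 _ (measurableTypeR R) _ lebesgue_measure D [set 0] mD _ D0 (lebesgue_measure_set1 0)).
- by exists n.+1%:R^-1 => //; rewrite invr_gt0.
Qed.

Lemma normal_small_tail (delta : R) : 0 < delta ->
  exists2 M : R, 0 < M & (N01 [set x | (M < `|x|)%R] <= delta%:E)%E.
Proof.
move=> delta0; pose F n := [set x : R | n.+1%:R < `|x|].
have FE n : F n = ~` `[- n.+1%:R, n.+1%:R]%classic.
  apply/seteqP; split => x; rewrite /F /= in_itv/= -ler_norml.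
    by rewrite ltNge => /negP.
  by move/negP; rewrite -ltNge.
have [|||n nP] := @vanishing_intersection _ _ N01 F delta delta0.
- by move=> n; rewrite FE; apply: measurableC; exact: measurable_itv.
- by move=> n m nm x /=; apply: le_lt_trans; rewrite ler_nat.
- rewrite (_ : \bigcap_n F n = set0) ?measure0//.
  apply/seteqP; split => x //= Fx; have := Fx (Num.bound `|x|) I.
  rewrite /F/= ltNge (le_trans (ltW (archi_boundP (normr_ge0 x))))//.
  by rewrite ler_nat.
- by exists n.+1%:R.
Qed.

Lemma geometric_null d (T : measurableType d) (mu : {measure set T -> \bar R})
    (A : set T) : (forall n, (mu A <= (1 / (2 ^ n.+1)%:R)%:E)%E) -> mu A = 0%E.
Proof.
move=> An; apply/eqP; rewrite eq_le measure_ge0 andbT; apply/lee_addgt0Pr => x x0.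
rewrite add0e; have [n nx] := ltr_add_invr x0; rewrite add0r in nx.
rewrite (le_trans (An n))// lee_fin (le_trans _ (ltW nx))// div1r.
by rewrite lef_pV2 ?posrE ?ltr0n ?expn_gt0// ler_nat; exact/ltnW/ltn_expl.
Qed.

Lemma geometric_lim_sup_null d (T : measurableType d) (mu : {measure set T -> \bar R})
    (F : nat -> set T) : (forall n, measurable (F n)) ->
  (forall n, (mu (F n) <= (1 / (2 ^ n.+1)%:R)%:E)%E) -> mu (lim_sup_set F) = 0%E.
Proof.
move=> mF Fn; apply: lim_sup_set_cvg0 => //.
apply: (@le_lt_trans _ _ 1%:E); last exact: ltry.
apply: (le_trans _ (epsilon_trick0 xpredT (ler01 : 0 <= 1 :> R))).
by apply: lee_nneseries => // n _; exact: Fn.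
Qed.

(** The gap reads [K * k' < k] instead of a bound on a quotient in order to admit [k' = 0]:
    conditioning may make a functional deterministic. *)
Lemma singular_of_functionals (T s : R) (mu nu : probability (cspace T) R) :
  (forall K, exists (phi : cspace T -> R) (k k' : R),
    [/\ 0 <= k', K * k' < k,
      forall D, measurable D -> eval_sigma_algebra s (phi @^-1` D),
      forall D, measurable D -> mu (phi @^-1` D) = N01 ((fun x => k * x) @^-1` D) &
      forall D, measurable D -> nu (phi @^-1` D) = N01 ((fun x => k' * x) @^-1` D)]) ->
  singular_on (eval_sigma_algebra s) mu nu.
Proof.
move=> Kphi.
have d0 n : 0 < 1 / (2 ^ n.+1)%:R :> R by rewrite div1r invr_gt0 ltr0n expn_gt0.
have /choice[A AP] n : exists A : set (cspace T), [/\ eval_sigma_algebra s A,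
    (mu A <= (1 / (2 ^ n.+1)%:R)%:E)%E & (nu (~` A) <= (1 / (2 ^ n.+1)%:R)%:E)%E].
  have [eps eps0 epsN] := normal_small_ball (d0 n).
  have [M M0 MN] := normal_small_tail (d0 n).
  (* With $K=M/\varepsilon$ one gets $k'M<\varepsilon k$, so under [nu] the event
     $|\varphi|>\varepsilon k$ requires a standard normal beyond $M$. *)
  have [phi [k [k' [k'0 Kk sphi muphi nuphi]]]] := Kphi (M / eps).
  have k0 : 0 < k by rewrite (le_lt_trans _ Kk)// mulr_ge0// divr_ge0// ltW.
  pose D := `[- (eps * k), eps * k]%classic.
  have mD : measurable (D : set R) by exact: measurable_itv.
  have DE (x : R) : D x <-> `|x| <= eps * k.
    by rewrite /D /= in_itv/= ler_norml.
  exists (phi @^-1` D); split; first exact: sphi.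
    rewrite muphi// (_ : _ @^-1` D = [set x | `|x| <= eps])//.
    apply/seteqP; split => x /=; rewrite DE normrM (gtr0_norm k0) mulrC ler_pM2r//.
  rewrite preimage_setC nuphi; last exact: measurableC.
  apply: le_trans MN; apply: le_measure; rewrite ?inE.
  - apply: (@measurable_preimage _ _ (measurableTypeR R) R); last exact: measurableC.
    exact: measurable_funM.
  - rewrite (_ : [set x | _] = ~` `[- M, M]%classic); first exact: measurableC.
    apply/seteqP; split => x /=; rewrite in_itv/= -ler_norml.
      by rewrite ltNge => /negP.
    by move/negP; rewrite -ltNge.
  - move=> x /= nD; rewrite ltNge; apply/negP => xM; apply: nD; apply/DE.
    rewrite normrM (ger0_norm k'0); apply: (@le_trans _ _ (k' * M)).
      exact: ler_wpM2l.
    move: Kk => /ltW; rewrite mulrAC ler_pdivrMr// => h.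
    by rewrite mulrC (le_trans h)// mulrC.
have sA n : eval_sigma_algebra s (A n) by case: (AP n).
have mA n : measurable (A n) by exact: eval_sigma_algebra_measurable (sA n).
exists (lim_sup_set A); split.
- have sC D : eval_sigma_algebra s D -> eval_sigma_algebra s (~` D : set (cspace T)).
    by move=> sD; rewrite -setTD; exact: (sigma_algebraCD sD).
  rewrite /lim_sup_set -[\bigcap_n _]setCK setC_bigcap.
  apply: (sC _); apply: sigma_algebra_bigcup => n.
  apply: (sC _); rewrite bigcup_mkcond.
  apply: sigma_algebra_bigcup => k; case: ifP => _; [exact: sA|exact: sigma_algebra0].
- by apply: geometric_lim_sup_null => // n; case: (AP n).
- rewrite /lim_sup_set setC_bigcap; apply/eqP; rewrite eq_le measure_ge0 andbT.
  have mI n : measurable (~` (\bigcup_(j >= n) A j)).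
    by apply: measurableC; exact: bigcup_measurable.
  rewrite (le_trans (measure_sigma_subadditive nu mI _ (fun x h => h)))//.
    exact: bigcupT_measurable.
  rewrite eseries0// => n _ _; apply: geometric_null => k.
  have [_ _ nk] := AP (n + k)%N.
  apply: (@le_trans _ _ (nu (~` A (n + k)%N))).
    apply: le_measure; rewrite ?inE//; first exact: measurableC.
    by apply: subsetC => x Ax; exists (n + k)%N => //=; exact: leq_addr.
  rewrite (le_trans nk)// lee_fin !div1r lef_pV2 ?posrE ?ltr0n ?expn_gt0//.
  by rewrite ler_nat leq_exp2l// ltnS leq_addl.
Qed.

End singularity.

Section evaluation_combinations.
Context {R : realType} (T : R).
Local Notation C := (cspace T).
Local Notation I := (`[0, T]%classic : Type).

(** Coefficients and times are sequences on [nat], which lets two combinations be concatenated by a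
    shift of indices. *)
Definition eval_combination (n : nat) (c : nat -> R) (r : nat -> I) (f : C) : R :=
  \sum_(i < n) c i * ceval f (r i).

Lemma eval_combination_linear n c r : linear (eval_combination n c r).
Proof.
move=> k x y; rewrite /eval_combination scaler_sumr -big_split; apply: eq_bigr => i _.
rewrite -[ceval (k *: x + y) _]/(k * ceval x (r i) + ceval y (r i)) mulrDr.
by congr (_ + _); exact: mulrCA.
Qed.

HB.instance Definition _ n c r := GRing.isLinear.Build R C R _
  (eval_combination n c r) (eval_combination_linear n c r).

Lemma eval_combination_continuous n c r : continuous (eval_combination n c r).
Proof.
move=> f; apply: (cvg_finite_sum (nbhs_filter f)) => i _.
apply: (@cvgM _ _ (nbhs f) (nbhs_filter f)); first exact: cvg_cst.
exact: continuous_eval_at.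
Qed.

Lemma eval_combination_sigma s n c r D : (forall i, \val (r i) <= s) ->
  measurable D -> eval_sigma_algebra s (eval_combination n c r @^-1` D).
Proof.
move=> rs mD.
have := @combination_g_sigma_preimage R C n (fun (i : 'I_n) (f : C) => ceval f (r i))
  (fun i : 'I_n => c i) D mD.
apply: smallest_sub; first exact: smallest_sigma_algebra.
move=> A; rewrite -bigcup_seq => -[i _ Ai]; apply: sub_sigma_algebra.
by exists (r i) => //; exact: rs.
Qed.

Lemma eval_combinationD n m c c' r r' f :
  eval_combination (n + m) (fun i => if (i < n)%N then c i else c' (i - n)%N)
    (fun i => if (i < n)%N then r i else r' (i - n)%N) f =
  eval_combination n c r f + eval_combination m c' r' f.
Proof.
rewrite /eval_combination big_split_ord; congr (_ + _); apply: eq_bigr => i _ /=.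
  by rewrite ltn_ord.
by rewrite ltnNge leq_addr/= addKn.
Qed.

Lemma eval_combinationZ n k c r f :
  eval_combination n (fun i => k * c i) r f = k * eval_combination n c r f.
Proof.
by rewrite /eval_combination mulr_sumr; apply: eq_bigr => i _; rewrite mulrA.
Qed.

End evaluation_combinations.

(** * The matching criterion *)

Section matching.
Context {R : realType} (T s : R) {H : completeNormedModType R}.
Variable dot : {dot H for (@idfun R)}.
Hypotheses (dot_norm : hilbert_norm dot) (H_separable : separable H).
Local Notation C := (cspace T).
Local Notation I := (`[0, T]%classic : Type).
Variable r0 : I.
Hypothesis r0s : \val r0 <= s.
Variable u : {linear H -> C}.
Hypothesis u_cont : continuous u.
Variables (N : nat) (a : 'I_N -> {linear C -> R}).
Hypothesis a_cont : forall i, continuous (a i).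
Variable e : 'I_N -> H.
Hypothesis e_basis : padded_orthonormal_basis dot (detached_space dot u a) e.

Lemma projectD k x y : project dot e k (x + y) = project dot e k x + project dot e k y.
Proof.
rewrite /project addrACA -opprD -big_split; congr (_ - _).
by apply: eq_bigr => i _; rewrite dotDr scalerDl.
Qed.

Lemma projectZ k t x : project dot e k (t *: x) = t *: project dot e k x.
Proof.
rewrite /project scalerBr scaler_sumr; congr (_ - _).
by apply: eq_bigr => i _; rewrite dotZr scalerA.
Qed.

Definition has_matching := exists e' : 'I_N -> H, forall i,
  reduced_space u a (e' i) /\
  forall x : `[0, T]%classic, \val x <= s -> ceval (u (e' i)) x = ceval (u (e i)) x.

(* If the standard deviation |k| of every evaluation combination is controlled by
   its conditioned one |project k|, then phi |-> phi (u e_j) is a bounded functional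
   of [project k], and the vector representing it provides e'_j. *)
Lemma bounded_variance_matched (K : R) :
  (forall n c r k, (forall i, \val (r i) <= s) ->
    (forall x, eval_combination n c r (u x) = dot k x) ->
    `|k| <= K * `|project dot e N k|) -> has_matching.
Proof.
move=> bound.
suff /choice[e' e'P] : forall j, exists y, reduced_space u a y /\
    forall x : `[0, T]%classic, \val x <= s -> ceval (u y) x = ceval (u (e j)) x.
  by exists e'.
move=> j; pose G : set (H * R) := [set p | exists n c r k,
  [/\ forall i, \val (r i) <= s, forall x, eval_combination n c r (u x) = dot k x,
      p.1 = project dot e N k & p.2 = dot k (e j)]].
have [||||y yG] := @riesz_graph R H dot dot_norm G (K * `|e j|).
- exists 0%N, (fun=> 0), (fun=> r0), 0; split => //=.
  + by move=> x; rewrite /eval_combination big_ord0 dot0l.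
  + by rewrite /project big1 ?subr0// => i _; rewrite dot0r scale0r.
  + by rewrite dot0l.
- move=> p q [n [c [r [k [rs rk pk pc]]]]] [n' [c' [r' [k' [rs' rk' pk' pc']]]]].
  exists (n + n')%N, (fun i => if (i < n)%N then c i else c' (i - n)%N).
  exists (fun i => if (i < n)%N then r i else r' (i - n)%N), (k + k'); split => /=.
  + by move=> i; case: ifP => _; [exact: rs|exact: rs'].
  + by move=> x; rewrite eval_combinationD rk rk' dotDl.
  + by rewrite pk pk' projectD.
  + by rewrite pc pc' dotDl.
- move=> t p [n [c [r [k [rs rk pk pc]]]]].
  exists n, (fun i => t * c i), r, (t *: k); split => //=.
  + by move=> x; rewrite eval_combinationZ rk dotZl.
  + by rewrite pk projectZ.
  + by rewrite pc dotZl.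
- move=> p [n [c [r [k [rs rk -> ->]]]]].
  rewrite (le_trans (dot_norm_le dot_norm _ _))// mulrAC.
  by rewrite ler_wpM2r//; exact: bound rs rk.
(* Projecting puts [y] into $H^{(A)}$; by self-adjointness $\langle k,\pi y\rangle=\langle\pi
   k,y\rangle$, which is $\langle k,e_j\rangle$. *)
exists (project dot e N y); split; first exact: (project_reduced dot_norm u_cont a_cont e_basis).
move=> x xs.
have ex z : eval_combination 1 (fun=> 1) (fun=> x) (u z) = ceval (u z) x.
  by rewrite /eval_combination big_ord1 mul1r.
have [k kE] := continuous_functional_riesz dot_norm u_cont
  (@eval_combination_continuous R T 1 (fun=> 1) (fun=> x)).
rewrite -!ex !kE -(project_dotC dot e N k y) dotC.
apply: (yG (project dot e N k, dot k (e j))).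
by exists 1%N, (fun=> 1), (fun=> x), k.
Qed.

Variable B : 'M[R]_N.
Hypothesis BE : forall j x, \sum_i B i j * a i (u x) = dot (e j) x.

(** [nu] and [nu'] are kept apart since the law of the conditioned process is identified on
    $\mathcal F_s$ only. *)
Lemma not_matched_singular (mu nu : probability C R) (nu' : set C -> \bar R) :
  ~ has_matching -> generates dot u mu -> generates dot (conditioning u a e B N \o u) nu' ->
  (forall A, eval_sigma_algebra s A -> nu A = nu' A) ->
  singular_on (eval_sigma_algebra s) mu nu.
Proof.
move=> nm gmu gnu nuE; apply: singular_of_functionals => K.
have : exists n c r k, [/\ forall i, \val (r i) <= s,
    forall x, eval_combination n c r (u x) = dot k x &
    K * `|project dot e N k| < `|k|].
  apply: contrapT => nex; apply: nm; apply: (@bounded_variance_matched K).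
  move=> n c r k rs rk; rewrite leNgt; apply/negP => Kk; apply: nex.
  by exists n, c, r, k.
move=> [n [c [r [k [rs rk Kk]]]]].
exists (eval_combination n c r), `|k|, `|project dot e N k|; split => //.
- by move=> D mD; exact: eval_combination_sigma.
- move=> D mD; apply: (generates_functional_law dot_norm H_separable gmu _ rk mD).
  exact: eval_combination_continuous.
- move=> D mD; rewrite nuE; last exact: eval_combination_sigma.
  apply: (generates_functional_law dot_norm H_separable gnu _ _ mD).
    exact: eval_combination_continuous.
  by move=> x /=; rewrite (conditioning_generator BE) rk project_dotC.
Qed.

Lemma matched_equivalent (mu : set C -> \bar R) : has_matching -> generates dot u mu ->
  equivalent_on (@eval_sigma_algebra R T s) mu
    (fun A => mu (conditioning u a e B N @^-1` A)).
Proof.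
move=> [e' e'P] gmu.
pose psi k : {linear C -> C} := conditioning u a e B k.
have gpsi k : generates dot (psi k \o u) (fun A => mu (psi k @^-1` A)).
  by apply: generates_comp gmu; exact: conditioning_continuous.
have [m mN [ee e0]] := padded_basis_dot e_basis.
suff chain k : (k <= N)%N -> equivalent_on (@eval_sigma_algebra R T s) mu
    (fun A => mu (psi k @^-1` A)) by exact: chain.
elim: k => [_|k IHk kN].
  have psi0 f : psi 0%N f = f by rewrite /psi /= /conditioning big1 ?subr0.
  by move=> A _; rewrite (_ : psi 0%N @^-1` A = A)//; apply/seteqP; split => f /=; rewrite psi0.
suff step : equivalent_on (@eval_sigma_algebra R T s)
    (fun A => mu (psi k @^-1` A)) (fun A => mu (psi k.+1 @^-1` A)).
  move=> A sA; exact: iff_trans (IHk (ltnW kN) A sA) (step A sA).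
pose j := Ordinal kN.
have sumS (V : zmodType) (F : 'I_N -> V) :
    \sum_(i < N | (i < k.+1)%N) F i = F j + \sum_(i < N | (i < k)%N) F i.
  rewrite (bigD1 j)//=; congr (_ + _); apply: eq_bigl => i.
  by rewrite ltnS [RHS]ltn_neqAle andbC.
(* A padding vector is zero, and removing it changes nothing. *)
have [jm|mj] := ltnP j m; last first.
  have psiS f : psi k.+1 f = psi k f.
    by rewrite /psi /= /conditioning sumS e0// linear0 scaler0 add0r.
  move=> A _; rewrite (_ : psi k.+1 @^-1` A = psi k @^-1` A)//.
  by apply/seteqP; split => f /=; rewrite psiS.
have ejk (i : 'I_N) : (i < k)%N -> dot (e i) (e j) = 0.
  move=> ik; rewrite ee (_ : (i == j) = false)//.
  by apply/eqP => ij; move: ik; rewrite ij ltnn.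
have projej : project dot e k (e j) = e j.
  by rewrite /project big1 ?subr0// => i ik; rewrite ejk// scale0r.
have [e'r e'u] := e'P j.
have psiE x : (psi k \o u) x = u (project dot e k x).
  exact: (conditioning_generator BE).
apply: (projected_null_sets dot_norm H_separable (v := psi k \o u) (e := e j) (e' := e' j)
  (gpsi k) (gpsi k.+1)).
- by rewrite ee eqxx jm.
- exact: reduced_orthogonal e_basis _ _ e'r.
- move=> x; rewrite /psi /= !(conditioning_generator BE).
  have -> : project dot e k.+1 x = project dot e k x - dot (e j) x *: e j.
    by rewrite /project sumS opprD addrCA addrC.
  by rewrite -scaleNr projectD projectZ projej scaleNr.
(* The matching survives the earlier removals: [e' j] lies in $H^{(A)}$ and [e j] is orthogonal to
   the vectors already removed, so [project k] fixes both. *)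
- have h1 : (psi k \o u) (e' j) = u (e' j).
    rewrite psiE project_id// => i; exact: reduced_orthogonal e_basis _ _ e'r.
  have h2 : (psi k \o u) (e j) = u (e j) by rewrite psiE projej.
  move=> x xs; apply: etrans (congr1 (@ceval R T ^~ x) h1) _.
  exact: etrans (e'u x xs) (esym (congr1 (@ceval R T ^~ x) h2)).
Qed.

End matching.

Theorem theorem3p1 (R : realType) (T s : R) (s_ge0 : 0 <= s) (s_leT : s <= T)
    (H : completeNormedModType R) (dot : {dot H for (@idfun R)})
    (dot_norm : hilbert_norm dot) (H_separable : separable H)
    (u : {linear H -> cspace T}) (u_bounded : bounded_near u (nbhs (0 : H)))
    (d : measure_display) (Omega : measurableType d) (P : probability Omega R)
    (X : {mfun Omega >-> cspace T})
    (X_gaussian : gaussian_process P X) (X_centered : centered_process P X)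
    (X_generated : generated_by dot u P X)
    (N : nat) (a : 'I_N -> {linear cspace T -> R})
    (a_continuous : forall i, continuous (a i))
    (d' : measure_display) (Omega' : measurableType d') (Q : probability Omega' R)
    (Y : {mfun Omega' >-> cspace T}) (Y_conditioned : conditioned_process P X a Q Y)
    (e : 'I_N -> H)
    (e_basis : padded_orthonormal_basis dot (detached_space dot u a) e) :
  let PX := distribution P X in
  let PY := distribution Q Y in
  let Fs := eval_sigma_algebra (T := T) s in
  let matched := exists e' : 'I_N -> H, forall i,
    reduced_space u a (e' i) /\
    forall x : `[0, T]%classic, \val x <= s ->
      ceval (u (e' i)) x = ceval (u (e i)) x in
  (equivalent_on Fs PX PY <-> matched) /\ (~ matched -> singular_on Fs PX PY).
Proof.
move=> PX PY Fs matched.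
have T_ge0 : 0 <= T := le_trans s_ge0 s_leT.
have u_cont : continuous u by apply/linear_bounded_continuous.
have gPX : generates dot u PX.
  move=> h bh d0 O0 P0 w wN wI; have [S [cS lS]] := X_generated h bh _ _ P0 w wN wI.
  by exists S; split => //; exact: measurable_funPT.
have [B BE] := basis_from_conditions dot_norm u_cont a_continuous e_basis.
pose psi : {linear cspace T -> cspace T} := conditioning u a e B N.
have psi_cont : continuous psi by exact: conditioning_continuous.
have gPY := generates_comp psi_cont gPX.
have PYE A : Fs A -> PY A = PX (psi @^-1` A).
  by move=> FA; apply: (conditioned_law T_ge0 dot_norm H_separable u_cont gPX
    a_continuous Y_conditioned e_basis BE FA).
have T0 : (0 : R) \in `[0, T]%classic by rewrite inE/= in_itv/= lexx.
pose r0 : `[0, T]%classic := exist _ 0 T0.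
have sing : ~ matched -> singular_on Fs PX PY.
  move=> nm; apply: (@not_matched_singular R T s H dot dot_norm H_separable r0 s_ge0 u u_cont N a
    a_continuous e e_basis B BE (distribution P X) (distribution Q Y) _ nm gPX gPY PYE).
split => //; split => [PXY|mt].
  (* A separating event would be [PY]-null by equivalence, together with its complement, against
     total mass one. *)
  apply: contrapT => /sing[A [FA A0 cA0]].
  have mA : measurable A := eval_sigma_algebra_measurable FA.
  have /(PXY A FA) nA0 := A0.
  have : (0 = 1 - distribution Q Y A :> \bar R)%E.
    exact: etrans (esym cA0) (probability_setC (distribution Q Y) mA).
  rewrite (_ : distribution Q Y A = 0%E) ?sube0 => [/eqP|]; last exact: nA0.
  by rewrite eqe eq_sym oner_eq0.
move=> A FA; rewrite PYE//.
exact: (matched_equivalent dot_norm H_separable a_continuous e_basis BE mt gPX).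
Qed.
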